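(* For $x_0\in\mathbb{R}^n$, let $u^\infty$ and $x^\infty$ be the optimal control and the associated trajectory, respectively, for $(OCP)_\infty$ starting from $x_0$. Then: 1. $x^\infty$ admits a unique extremal lift $(x^\infty,p^\infty)$, i.e. there is a unique absolutely continuous $p^\infty:[0,\infty)\to\mathbb{R}^n$ such that $(x^\infty,p^\infty)$ is a solution on $[0,\infty)$ of $$\dot x=J_nx+\lfloor p_n\rceil^{\frac1{q-1}}e_n,\qquad \dot p=-J_n^\top p+\nabla F(x),$$ and $u^\infty=\lfloor p^\infty_n\rceil^{\frac{1}{q-1}}$. 2. There exists a $\mathcal{K}_\infty$-function $C(\cdot)$ (independent of $x_0$) such that $\|(x^\infty,p^\infty,u^\infty)\|_\infty\le C(\|x_0\|)$ for every $x_0\in\mathbb{R}^n$, where $\|\cdot\|_\infty$ is the supremum norm over $t\ge 0$; moreover $\lim_{t\to\infty}(x^\infty(t),p^\infty(t),u^\infty(t))=(0,0,0)$.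
   Context: Let $n\ge 1$ be an integer and $q\in(1,\infty)$. $J_n$ is the $n\times n$ Jordan block with eigenvalue $0$ (ones on the superdiagonal, zeros elsewhere) and $e_n$ is the last canonical basis vector of $\mathbb{R}^n$. The control system is $\dot x=J_nx+e_nu$. The function $F:\mathbb{R}^n\to\mathbb{R}_{\ge 0}$ is continuously differentiable, convex and positive definite ($F(0)=0$, $F(x)>0$ for $x\ne0$). For $x_0\in\mathbb{R}^n$ and $u\in L^q(\mathbb{R}_{\ge0},\mathbb{R})$, $\mathcal{J}_\infty(x_0,u)=\int_0^\infty\left(\frac{|u(t)|^q}{q}+F(x(t))\right)dt$, where $x(\cdot)$ is the trajectory of the control system with $x(0)=x_0$ and control $u$. $(OCP)_\infty$ is the problem of minimizing $u\mapsto\mathcal{J}_\infty(x_0,u)$ over $L^q(\mathbb{R}_{\ge0},\mathbb{R})$; for every $x_0$ it has a unique minimizer, called the optimal control, and the corresponding trajectory is the optimal trajectory. For $a\in\mathbb{R}$ and $r>0$, $\lfloor a\rceil^r=|a|^r\,\mathrm{sgn}(a)$. A $\mathcal{K}_\infty$-function is a continuous, strictly increasing, unbounded function $\alpha:\mathbb{R}_{\ge0}\to\mathbb{R}_{\ge0}$ with $\alpha(0)=0$. The control $u^\infty$ is identified with its continuous representative. *)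

(* Defs.v *)
From HB Require Import structures.
From mathcomp Require Import all_boot all_order all_algebra.
From mathcomp Require Import all_classical all_reals all_analysis.

Set Implicit Arguments.
Unset Strict Implicit.
Unset Printing Implicit Defensive.

Import Order.TTheory GRing.Theory Num.Theory.
Import numFieldNormedType.Exports.

Local Open Scope classical_set_scope.
Local Open Scope ring_scope.

(* The state space is 'cV[R]_n.+1, so that its dimension n.+1 is at least 1.
   Time-dependent functions have type R -> _, but only their values on
   [0, +oo[ matter. *)

Definition spow {R : realType} (a r : R) : R := `|a| `^ r * Num.sg a.

Definition jordan {R : realType} (n : nat) : 'M[R]_n.+1 :=
  \matrix_(i, j) ((j == i.+1 :> nat)%:R : R).

Definition elast {R : realType} (n : nat) : 'cV[R]_n.+1 := delta_mx ord_max 0.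

Definition gradient {R : realType} {n : nat} (F : 'cV[R]_n.+1 -> R)
    (x : 'cV[R]_n.+1) : 'cV[R]_n.+1 :=
  \col_i 'D_(delta_mx i 0) (F : 'cV[R]_n.+1 -> R^o) x.

Definition contdiff {R : realType} {n : nat} (F : 'cV[R]_n.+1 -> R) : Prop :=
  (forall x, differentiable (F : 'cV[R]_n.+1 -> R^o) x) /\
  continuous (gradient F).

Definition positive_definite {R : realType} {n : nat}
    (F : 'cV[R]_n.+1 -> R) : Prop :=
  F 0 = 0 /\ forall x, x != 0 -> 0 < F x.

(* The library norm on matrices is the maximum norm. *)
Definition euclidean_norm {R : realType} {m : nat} (v : 'cV[R]_m) : R :=
  Num.sqrt (\sum_i v i 0 ^+ 2).

Definition sup_norm {R : realType} {m : nat} (f : R -> 'cV[R]_m) : \bar R :=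
  ereal_sup [set (euclidean_norm (f t))%:E | t in `[0, +oo[%classic].

Definition abs_continuous {R : realType} {V : normedModType R} (a b : R)
    (f : R -> V) : Prop :=
  forall e : R, 0 < e -> exists2 d : R, 0 < d &
    forall (m : nat) (s t : 'I_m -> R),
      (forall i, a <= s i /\ s i <= t i /\ t i <= b) ->
      trivIset setT (fun i => `]s i, t i[%classic) ->
      \sum_(i < m) (t i - s i) < d ->
      \sum_(i < m) `|f (t i) - f (s i)| < e.

(* Caratheodory solution of x' = g on [0, +oo[; as usual, absolute continuity
   on the unbounded interval is required on its compact subintervals. *)
Definition ac_solution {R : realType} {n : nat} (x g : R -> 'cV[R]_n.+1) : Prop :=
  (forall T : R, 0 <= T -> abs_continuous 0 T x) /\
  {ae @lebesgue_measure R, forall t : R, 0 < t ->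
    is_derive (t : R^o) (1 : R^o) (x : R^o -> 'cV[R]_n.+1) (g t)}.

Definition trajectory {R : realType} {n : nat} (x0 : 'cV[R]_n.+1) (u : R -> R)
    (x : R -> 'cV[R]_n.+1) : Prop :=
  x 0 = x0 /\ ac_solution x (fun t => jordan n *m x t + u t *: elast n).

(* Controls are represented by functions, not by classes modulo equality
   almost everywhere; the restriction extends u by 0 outside [0, +oo[. *)
Definition admissible {R : realType} (q : R) (u : R -> R) : Prop :=
  u \_ (`[0, +oo[%classic) \in Lfun (@lebesgue_measure R) q%:E.

Definition cost {R : realType} {n : nat} (q : R) (F : 'cV[R]_n.+1 -> R)
    (u : R -> R) (x : R -> 'cV[R]_n.+1) : \bar R :=
  (\int[@lebesgue_measure R]_(t in `[0%R, +oo[)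
    (`|u t| `^ q / q + F (x t))%:E)%E.

Definition optimal {R : realType} {n : nat} (q : R) (F : 'cV[R]_n.+1 -> R)
    (x0 : 'cV[R]_n.+1) (u : R -> R) (x : R -> 'cV[R]_n.+1) : Prop :=
  [/\ admissible q u, trajectory x0 u x &
      forall v y, admissible q v -> trajectory x0 v y ->
        (cost q F u x <= cost q F v y)%E].

Definition continuous_representative {R : realType} (u ubar : R -> R) : Prop :=
  {within `[0, +oo[, continuous ubar} /\
  u = ubar %[ae @lebesgue_measure R in `[0, +oo[%classic].

Definition extremal_lift {R : realType} {n : nat} (q : R)
    (F : 'cV[R]_n.+1 -> R) (x p : R -> 'cV[R]_n.+1) : Prop :=
  ac_solution x
    (fun t => jordan n *m x t + spow (p t ord_max 0) (q - 1)^-1 *: elast n) /\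
  ac_solution p (fun t => - ((jordan n)^T *m p t) + gradient F (x t)).

Definition K_infinity {R : realType} (C : R -> R) : Prop :=
  [/\ {within `[0, +oo[, continuous C}, C 0 = 0,
      forall r s, 0 <= r -> r < s -> C r < C s &
      forall M, exists2 r, 0 <= r & M < C r].

(* Main.v *)
(** A polynomial phi with ('X - b)^(n+1) | phi yields a control phi^(n+1) and a
state (phi, phi', ..., phi^(n)) that reaches 0 at time b and is then continued
by 0.  Such pairs steer any initial state to 0 at time 1, so optimal costs are
finite and tend to 0 with x0.  They also serve as variations of the optimal
pair: difference quotients of the convex cost are dominated by their values at
step 1, so the first variation (spow u (q - 1), grad F x) annihilates every
test pair that starts at 0.  Let p solve the adjoint equation, with p 0 chosen
so that this also holds for the n + 1 steering pairs.  Testing against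
phi = ('X - b)^(n+1) / (n+1)!, whose control is 1 on [0, b], gives
int_0^b (spow u (q - 1) - p_n) = 0 for all b, hence u = spow p_n (q - 1)^-1.
Uniqueness holds because x determines p_n through its derivative, and p_i
determines p_(i-1) through the adjoint equation.

For the bounds, let e(t) be the running cost spent during [t, t + 1].  Since F
is convex and positive definite it grows at least linearly, so integrating the
derivative of (t + 1 - s) x_i(s) bounds x(t) by 3 r + K_r e(t) for every r > 0;
integrating that of \sum_i p_i(s) phi^(i)(s - t) with phi a steering polynomial
bounds p(t) likewise, grad F being small where x is small.  As e is at most the
optimal cost and tends to 0 at infinity, this gives a nondecreasing bound in
|x0| that vanishes at 0, and the limit. *)

Require Import Defs.
From HB Require Import structures.
From mathcomp Require Import all_boot all_order all_algebra.
From mathcomp Require Import all_classical all_reals all_analysis.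
From mathcomp Require Import measurable_realfun ring lra.

Set Implicit Arguments.
Unset Strict Implicit.
Unset Printing Implicit Defensive.

Import Order.TTheory GRing.Theory Num.Theory.
Import numFieldNormedType.Exports.

Local Open Scope classical_set_scope.
Local Open Scope ring_scope.

(** * Absolutely continuous functions of time *)

(** Solutions are weak: the equations hold only almost everywhere. The bridge to classical calculus
    is that an absolutely continuous function with zero derivative almost everywhere is constant.
    Along an extremal lift the right-hand sides are continuous, so the lift satisfies its equations
    at every positive time, and the later estimates are mean value inequalities.

    [F] is convex but may grow arbitrarily fast, so a general variation of the control may make the
    cost infinite. Test pairs therefore have compact support, which confines the change of [F (x t)]
    to a bounded time interval. The price is that no condition at infinity is at hand to select [p];
    test pairs with nonzero initial state determine [p 0] instead.

    The constants of the window estimates depend on [r] and not on the lift. The same two estimates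
    thus give boundedness, smallness for small initial states, and the limit. The best bound as a
    function of the size of the initial state is a supremum, which may jump; averaging it produces a
    continuous, strictly increasing majorant. *)

Section absolute_continuity.
Context {R : realType}.
Local Notation mu := (@lebesgue_measure R).

Lemma abs_continuous_seq (V : normedModType R) (a b : R) (f : R -> V) :
  abs_continuous a b f -> forall e : R, 0 < e -> exists2 d : R, 0 < d &
    forall l : seq (R * R),
      all (fun p => [&& a <= p.1, p.1 <= p.2 & p.2 <= b]) l ->
      pairwise (fun p q => q.2 <= p.1) l ->
      \sum_(p <- l) (p.2 - p.1) < d ->
      \sum_(p <- l) `|f p.2 - f p.1| < e.
Proof.
move=> fac e e0; have [d d0 hd] := fac _ e0; exists d => // l /allP/= hl lp.
rewrite 2!(big_nth ((0, 0) : R * R)) !big_mkord => ld.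
apply: (hd (size l) (fun i => (nth (0, 0) l i).1) (fun i => (nth (0, 0) l i).2)) => //.
  by move=> i; have /hl/and3P[] := mem_nth (0, 0) (ltn_ord i).
apply/trivIsetP => i j _ _; wlog ij : i j / (i < j)%N => [H|] ij0.
  have [ij|ji|/val_inj ij] := ltngtP i j; first exact: H.
    by rewrite setIC; apply: H => //; rewrite eq_sym.
  by rewrite ij eqxx in ij0.
have /(pairwiseP (0, 0))/(_ i j (ltn_ord i) (ltn_ord j) ij) := lp.
move=> le_ji; rewrite -subset0 => x [] /=; rewrite !in_itv/= => /andP[ix _] /andP[_ xj].
by have := lt_le_trans (lt_trans ix xj) le_ji; rewrite ltxx.
Qed.

Lemma is_derive_cvg (V W : normedModType R) (f : V -> W) (x v : V) (df : W) :
  is_derive x v f df -> h^-1 *: (f (h *: v + x) - f x) @[h --> 0^'] --> df.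
Proof. by case=> d <-; exact: d. Qed.

Lemma cvg_is_derive (V W : normedModType R) (f : V -> W) (x v : V) (df : W) :
  h^-1 *: (f (h *: v + x) - f x) @[h --> 0^'] --> df -> is_derive x v f df.
Proof. by move=> H; apply: DeriveDef; [exact: cvgP H|exact: cvg_lim H]. Qed.

(** Real induction along [[a, b]] takes the place of a covering theorem. Off a null set, zero
    derivative makes [f] move by at most [e] times the time elapsed; the null set is enclosed in an
    open set so small that absolute continuity bounds the total movement across it. *)
Lemma null_derive_cst (a b : R) (f : R -> R) : a <= b ->
  abs_continuous a b (f : R -> R^o) ->
  {ae mu, forall t, a < t < b -> is_derive t 1 f 0} ->
  f b = f a.
Proof.
move=> ab fac [N0 [mN0 N00 hN0]].
(* The endpoints join the exceptional set because the derivative is only known strictly between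
   them. *)
pose N : set R := N0 `|` [set a] `|` [set b].
have mN : measurable N by do 2! apply: measurableU => //.
have N_0 : mu N = 0%E.
  apply: measure_negligible => //; do 2 try apply: negligibleU.
  - by exists N0; split.
  - by exists [set a]; split => //; exact: lebesgue_measure_set1.
  - by exists [set b]; split => //; exact: lebesgue_measure_set1.
have gN t : a <= t <= b -> ~ N t -> is_derive t 1 f 0.
  move=> /andP[at_ tb] Nt; have tN0 : ~ N0 t by move=> ?; apply: Nt; left; left.
  have : ~ ~ (a < t < b -> is_derive t 1 f 0) by move=> /hN0.
  move/contrapT; apply; rewrite !lt_neqAle at_ tb !andbT; apply/andP; split; apply/eqP => E.
    by apply: Nt; left; right.
  by apply: Nt; right.
(* The term [e * (b - a)] pays for the good steps, the extra [e] for all intervals taken from [U]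
   together. *)
suff fe (e : R) : 0 < e -> `|f b - f a| <= e * (b - a + 1).
  apply/eqP; rewrite -subr_eq0 -normr_le0; apply/ler_addgt0Pl => e e0; rewrite addr0.
  have ba : 0 < b - a + 1 by rewrite ltr_wpDl// subr_ge0.
  have := fe (e / (b - a + 1)); rewrite divr_gt0// => /(_ isT).
  by rewrite divfK// gt_eqF.
move=> e0; have [d d0 hd] := abs_continuous_seq fac e0.
have [U [oU NU muU]] : exists U : set R, [/\ open U, N `<=` U & (mu (U `\` N) < d%:E)%E].
  by apply: lebesgue_regularity_outer => //; rewrite [X in (X < _)%E]N_0.
have mU : measurable U by exact: open_measurable.
have {}muU : (mu U < d%:E)%E.
  apply: le_lt_trans muU; have /setIidr UN := NU.
  have -> : mu U = (mu (U `\` N) + mu N)%E by rewrite -[in X in (_ + X)%E]UN; exact: measureDI.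
  by rewrite N_0 adde0.
(* P t: [a, t] is covered by steps along which f moves by at most e per unit of
   time, and by disjoint intervals l taken from the small open set U. *)
pose phi t := mu (U `&` `]a, t]).
have phi_le t : (phi t <= mu U)%E.
  by apply: le_measure; rewrite ?inE//; exact: measurableI.
have phiD t t' : a <= t -> t <= t' -> (phi t' = phi t + mu (U `&` `]t, t']))%E.
  move=> at_ tt'; rewrite /phi -measureU//; [|exact: measurableI..|].
  - congr (mu _); rewrite -setIUr; congr (_ `&` _); apply/seteqP; split => x /=; rewrite !in_itv/=.
      by move=> /andP[ax xt']; case: (leP x t) => xt; [left|right]; apply/andP.
    move=> [/andP[ax xt]|/andP[tx xt']]; apply/andP; split => //.
      exact: le_trans tt'.
    exact: le_lt_trans tx.
  - rewrite setIACA setIid (_ : `]a, t] `&` `]t, t'] = set0) ?setI0//.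
    rewrite -subset0 => x [] /=; rewrite !in_itv/= => /andP[_ xt] /andP[tx _].
    by have := lt_le_trans tx xt; rewrite ltxx.
pose P t := exists l : seq (R * R), [/\ all (fun p => [&& a <= p.1, p.1 <= p.2 & p.2 <= t]) l,
  pairwise (fun p q => q.2 <= p.1) l, ((\sum_(p <- l) (p.2 - p.1))%:E <= phi t)%E &
  `|f t - f a| <= e * (t - a) + \sum_(p <- l) `|f p.2 - f p.1|].
have Pa : P a.
  by exists [::]; split => //; rewrite !big_nil ?subrr ?normr0 ?mulr0 ?addr0// measure_ge0.
have P_good t t' : a <= t -> t <= t' -> P t -> `|f t' - f t| <= e * (t' - t) -> P t'.
  move=> at_ tt' [l [/allP l1 l2 l3 l4]] ft; exists l; split => //.
  - by apply/allP => p /l1/and3P[-> ->/= /le_trans]; exact.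
  - by apply: le_trans l3 _; rewrite (phiD _ _ at_ tt') leeDl.
  - by rewrite -(subrKA (f t)) (le_trans (ler_normD _ _))//; lra.
(* The new interval lies in [U], so [phi] grows by exactly its length and the bound on the total
   length of [l] persists. *)
have P_bad t t' : a <= t -> t <= t' -> P t -> `]t, t'] `<=` U -> P t'.
  move=> at_ tt' [l [/allP l1 l2 l3 l4]] tU; exists ((t, t') :: l); split => /=.
  - by rewrite at_ tt' lexx/=; apply/allP => p /l1/and3P[-> ->/= /le_trans]; exact.
  - by rewrite l2 andbT; apply/allP => p /l1/and3P[].
  - rewrite big_cons/= (phiD _ _ at_ tt') addrC EFinD leeD//.
    by rewrite (setIidr tU) lebesgue_measure_itv/= lte_fin; case: ltP => // ?; rewrite lee_fin subr_le0.
  - rewrite big_cons/= -(subrKA (f t)) (le_trans (ler_normD _ _))//.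
    have : e * (t - a) <= e * (t' - a) by rewrite ler_wpM2l ?(ltW e0)// lerD2r.
    by lra.
pose S := [set t | a <= t <= b /\ P t].
have Sa : S a by rewrite /S/= lexx ab.
have Sub : ubound S b by move=> t [/andP[]].
have hS : has_sup S by split; [exists a|exists b].
pose c := sup S.
have ac : a <= c by exact: (sup_upper_bound hS).
have cb : c <= b by exact: ge_sup (proj1 hS) Sub.
(* Near the supremum [c] a single step leads from any time before [c] to any time after it: if [c]
   is in [N], the step stays inside [U]; otherwise the zero derivative at [c] controls [f] on both
   sides. *)
have [D D0 hD] : exists2 D, 0 < D & forall t t', a <= t -> t <= c -> c <= t' -> t' <= b ->
    c - D < t -> t' < c + D -> P t -> P t'.
  case: (pselect (N c)) => Nc.
    have /nbhs_ballP[D /= D0 hD] : nbhs c U by exact: open_nbhs_nbhs (conj oU (NU _ Nc)).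
    exists D => // t t' at_ tc ct' t'b ctD tcD Pt; apply: (P_bad t) => //; first exact: le_trans ct'.
    move=> x /=; rewrite in_itv/= => /andP[tx xt']; apply: hD.
    by rewrite /ball/= ltr_norml; apply/andP; split; lra.
  have dfc : is_derive c 1 f 0 by apply: gN; rewrite ?ac.
  have /cvgrPdist_le/(_ e e0) : h^-1 *: (f (h *: 1 + c) - f c) @[h --> 0^'] --> 0.
    exact: is_derive_cvg.
  move=> [D /= D0 hD]; exists D => // t t' at_ tc ct' t'b ctD tcD Pt.
  have fc x : c - D < x -> x < c + D -> `|f x - f c| <= e * `|x - c|.
    move=> xD1 xD2; have [->|xc] := eqVneq x c; first by rewrite !subrr normr0 mulr0.
    have := hD (x - c); rewrite /ball_/= sub0r normrN => /(_ _ _)/wrap[].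
      by rewrite ltr_norml; apply/andP; split; lra.
      by rewrite subr_eq0.
    rewrite [X in f X](_ : _ = x); last by rewrite [_ *: _]mulr1 subrK.
    rewrite sub0r normrN normrZ normfV ler_pdivrMl ?normr_gt0 ?subr_eq0//.
    by rewrite mulrC.
  apply: (P_good t) => //; first exact: le_trans ct'.
  rewrite -(subrKA (f c)) (le_trans (ler_normD _ _))// [`|f c - _|]distrC.
  have := fc t ctD _; have := fc t' _ tcD.
  rewrite (ger0_norm (x := t' - c)) ?subr_ge0// (ler0_norm (x := t - c)) ?subr_le0//.
  move=> /(_ _)/wrap[]; first lra.
  move=> h1 /(_ _)/wrap[]; first lra.
  by lra.
have [t [/andP[at_ tb] Pt] ct] : exists2 t, S t & c - D < t.
  by apply: sup_adherent.
have tc : t <= c by apply: (sup_upper_bound hS); split => //; rewrite at_.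
have Pt' t' : c <= t' -> t' <= b -> t' < c + D -> P t'.
  by move=> *; apply: (hD t t').
have cbE : c = b.
  apply/eqP; rewrite eq_le cb leNgt/=; apply/negP => cb'.
  pose t' := Order.min b (c + D / 2).
  have : t' <= c.
    apply: (sup_upper_bound hS); rewrite /S/=.
    have ct' : c <= t' by rewrite /t' le_min cb/=; lra.
    rewrite (le_trans ac)//= /t' ge_min lexx/=; split => //.
    by apply: Pt' => //; rewrite /t' ?ge_min ?lexx// gt_min; apply/orP; right; lra.
  by rewrite /t' ge_min !leNgt cb'/=; lra.
have [l [l1 l2 l3 l4]] : P b by apply: Pt' => //; rewrite ?cbE//; lra.
have := hd l l1 l2 _ => /(_ _)/wrap[].
  by rewrite -lte_fin (le_lt_trans l3)// (le_lt_trans (phi_le b)).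
by lra.
Qed.
End absolute_continuity.

(** * Primitives, and absolutely continuous functions with a continuous derivative *)

Section primitives.
Context {R : realType}.
Local Notation mu := (@lebesgue_measure R).
Implicit Types (f g h : R -> R) (t T : R).

(** Mean value inequality, from the monotonicity of [g - s * f] for [s = 1] and [s = -1]. Both
    window estimates are instances of it. *)
Lemma is_derive_le f f' g g' (a b : R) : a <= b ->
  continuous f -> continuous g ->
  (forall t, a < t < b -> is_derive t 1 f (f' t)) ->
  (forall t, a < t < b -> is_derive t 1 g (g' t)) ->
  (forall t, a < t < b -> `|f' t| <= g' t) ->
  `|f b - f a| <= g b - g a.
Proof.
move=> ab cf cg df dg fg.
have key (s : R) : `|s| = 1 -> s * f b - s * f a <= g b - g a.
  move=> s1; pose k t := g t - s * f t.
  have dk t : a < t < b -> is_derive t 1 k (g' t - s * f' t).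
    by move=> tab; apply: is_deriveB; [exact: dg|apply: is_deriveZ; exact: df].
  have : k a <= k b.
    apply: (@ger0_derive1_le_cc _ k a b).
    - by move=> t /[!in_itv]/= /dk[].
    - move=> t /[!in_itv]/= tab; rewrite derive1E (@derive_val _ _ _ _ _ _ _ (dk _ tab)).
      rewrite subr_ge0; apply: le_trans (fg _ tab); rewrite (le_trans (ler_norm _))//.
      by rewrite normrM s1 mul1r.
    - apply: continuous_subspaceT => x; apply: cvgB; first exact: cg.
      by apply: cvgMr; exact: cf.
    - by rewrite bound_itvE.
    - by rewrite bound_itvE.
    - by [].
  by rewrite /k; lra.
rewrite ler_norml; apply/andP; split; last by have := key 1 (normr1 _); lra.
by have := key (-1) (normrN1 _); lra.
Qed.

Lemma is_derive_eq0_cst f (a b : R) : a <= b -> continuous f ->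
  (forall t, a < t < b -> is_derive t 1 f 0) -> f b = f a.
Proof.
move=> ab cf df; apply/eqP; rewrite -subr_eq0 -normr_le0 -[leRHS](subrr (0 : R)).
apply: (@is_derive_le f (fun=> 0) (fun=> 0) (fun=> 0)) => //; first exact: cst_continuous.
by move=> t _; rewrite normr0.
Qed.

(* Continued by 0 for t < 0. *)
Definition prim h (t : R) : R := \int[mu]_(s in `[0, Num.max 0 t]) h s.

Lemma continuous_integrable h (a b : R) : continuous h -> mu.-integrable `[a, b] (EFin \o h).
Proof.
move=> ch; apply: continuous_compact_integrable; first exact: segment_compact.
exact: continuous_subspaceT.
Qed.

Lemma prim_le0 h t : t <= 0 -> prim h t = 0.
Proof. by move=> t0; rewrite /prim max_l// set_itv1 Rintegral_set1. Qed.

Lemma prim_derive h t : continuous h -> 0 < t -> is_derive t 1 (prim h) (h t).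
Proof.
move=> ch t0.
have [||||d1 d2] := @continuous_FTC1_closed _ h 0 t (t + 1).
- by rewrite ltrDl.
- exact: continuous_integrable.
- by [].
- exact: ch.
have : is_derive t 1 (fun x : R => \int[mu]_(s in `[0, x]) h s : R) (h t).
  by apply: DeriveDef; [exact: d1|rewrite -derive1E; exact: d2].
apply: near_eq_is_derive; near=> x; rewrite /prim max_r//.
by apply: ltW; near: x; exact: lt_nbhsr.
Unshelve. all: by end_near. Qed.

(* Only the values on [0, +oo[ of functions of time matter; freezing them on
   ]-oo, 0] turns continuity on the half-line into continuity on R. *)
Lemma continuous_max0 (T : topologicalType) (f : R -> T) :
  {within `[0, +oo[, continuous f} -> continuous (fun t => f (Num.max 0 t)).
Proof.
move=> /subspace_continuousP cf t.
have m0 : `[0, +oo[%classic (Num.max 0 t) by rewrite /= in_itv/= le_max lexx.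
apply: cvg_trans (cf _ m0) => P /= fP.
have cm : Num.max 0 x @[x --> t] --> Num.max 0 t.
  by apply: continuous_max; [exact: cvg_cst|exact: cvg_id].
have : nbhs t (fun x => P (f (Num.max 0 x))); last by [].
have H : \forall x \near t, `[0, +oo[%classic (Num.max 0 x) -> P (f (Num.max 0 x)) := cm _ fP.
near=> x; apply: (near H x) => //.
by rewrite /= in_itv/= le_max lexx.
Unshelve. all: by end_near. Qed.

Lemma continuous_within0 (T : topologicalType) (f g : R -> T) : continuous g ->
  (forall t, 0 <= t -> f t = g t) -> {within `[0, +oo[, continuous f}.
Proof.
move=> cg fg; apply/subspace_continuousP => t /= t0.
rewrite /from_subspace fg; last by move: t0; rewrite in_itv/= andbT.
apply: (@cvg_trans _ (g @ within `[0, +oo[%classic (nbhs t))).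
  by apply: near_eq_cvg; rewrite near_withinE; apply: nearW => x; rewrite /= in_itv/= andbT => /fg.
exact: cvg_within_filter (cg t).
Qed.

Lemma prim_continuous h : continuous h -> continuous (prim h).
Proof.
move=> ch t; have [t0|t0|t0] := ltgtP t 0.
- rewrite /continuous_at (prim_le0 _ (ltW t0)).
  have : (fun=> 0 : R) x @[x --> t] --> (0 : R) by exact: cvg_cst.
  apply: cvg_trans; apply: near_eq_cvg; near=> x; rewrite prim_le0//; apply: ltW; near: x; exact: lt_nbhsl.
- by apply: differentiable_continuous; apply/derivable1_diffP; case: (prim_derive ch t0).
- rewrite t0.
  have /(continuous_within_itvP _ ltr01)[_ /cvgrPdist_lt H _] :
    {within `[0, 1], continuous (fun x : R => \int[mu]_(s in `[0, x]) h s : R)}.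
    by apply: parameterized_integral_continuous; [exact: ler01|exact: continuous_integrable].
  apply/cvgrPdist_lt => e e0; have [d /= d0 hd] := H e e0; exists d => //= x xd.
  have [x0|x0] := leP x 0; first by rewrite !prim_le0 ?subrr ?normr0.
  by rewrite /prim (max_r (lexx 0)) (max_r (ltW x0)); exact: hd.
Unshelve. all: by end_near. Qed.

Lemma prim_integral h T : continuous h -> 0 <= T ->
  (\int[mu]_(t in `[0%R, T]) (h t)%:E = (prim h T)%:E)%E.
Proof.
move=> ch T0; rewrite /prim max_r// /Rintegral fineK//.
by apply: integrable_fin_num => //; exact: continuous_integrable.
Qed.

Lemma aeS (P Q : R -> Prop) : (forall t, P t -> Q t) ->
  {ae mu, forall t, P t} -> {ae mu, forall t, Q t}.
Proof. by apply: filterS; exact: (ae_filter_ringOfSetsType mu). Qed.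

Lemma aeS2 (P Q S : R -> Prop) : (forall t, P t -> Q t -> S t) ->
  {ae mu, forall t, P t} -> {ae mu, forall t, Q t} -> {ae mu, forall t, S t}.
Proof. by apply: filterS2; exact: (ae_filter_ringOfSetsType mu). Qed.

(** Common source of the closure properties: scalar multiples, coordinates and Lipschitz functions
    are all dominated in this way. *)
Lemma abs_continuous_dominated (V W : normedModType R) (a b K : R)
    (f : R -> V) (g : R -> W) : abs_continuous a b f ->
  (forall s t, a <= s -> s <= t -> t <= b -> `|g t - g s| <= K * `|f t - f s|) ->
  abs_continuous a b g.
Proof.
(* [K] may be zero or negative, hence the positive constant [|K| + 1]. *)
move=> fac gf e e0; have K0 : 0 < `|K| + 1 by rewrite ltr_wpDl.
have [|d d0 hd] := fac (e / (`|K| + 1)); first by rewrite divr_gt0.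
exists d => // m s t st tst sd.
apply: (@le_lt_trans _ _ (\sum_(i < m) (`|K| + 1) * `|f (t i) - f (s i)|)).
  apply: ler_sum => i _; have [si [sti ti]] := st i.
  apply: le_trans (gf _ _ si sti ti) _; apply: ler_wpM2r => //.
  by rewrite (le_trans (ler_norm K))// lerDl.
by rewrite -mulr_sumr -ltr_pdivlMl// mulrC hd.
Qed.

Lemma abs_continuousD (V : normedModType R) (a b : R) (f g : R -> V) :
  abs_continuous a b f -> abs_continuous a b g ->
  abs_continuous a b (fun t => f t + g t).
Proof.
move=> fac gac e e0.
have [|d d0 hd] := fac (e / 2); first by rewrite divr_gt0.
have [|d' d'0 hd'] := gac (e / 2); first by rewrite divr_gt0.
exists (Num.min d d'); first by rewrite lt_min d0.
move=> m s t st tst; rewrite lt_min => /andP[sd sd'].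
apply: (@le_lt_trans _ _ (\sum_(i < m) (`|f (t i) - f (s i)| + `|g (t i) - g (s i)|))).
  by apply: ler_sum => i _; rewrite opprD addrACA ler_normD.
by rewrite big_split/= (splitr e) ltrD ?hd ?hd'.
Qed.

Lemma abs_continuous_id (a b : R) : abs_continuous a b (id : R -> R^o).
Proof.
move=> e e0; exists e => // m s t st _; apply: le_lt_trans.
by apply: ler_sum => i _; have [_ [sti _]] := st i; rewrite ger0_norm ?subr_ge0.
Qed.

Lemma lipschitz_abs_continuous (V : normedModType R) (a b K : R) (f : R -> V) :
  (forall s t, a <= s -> s <= t -> t <= b -> `|f t - f s| <= K * (t - s)) ->
  abs_continuous a b f.
Proof.
move=> fK; apply: abs_continuous_dominated (abs_continuous_id a b) _ => s t as_ st tb.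
by rewrite [`|id t - _|]ger0_norm ?subr_ge0//; exact: fK.
Qed.

Lemma abs_continuous_continuous (V : normedModType R) (a b : R) (f : R -> V) e :
  abs_continuous a b f -> 0 < e -> exists2 d, 0 < d &
    forall s t, a <= s <= b -> a <= t <= b -> `|t - s| < d -> `|f t - f s| < e.
Proof.
move=> fac e0; have [d d0 hd] := fac e e0; exists d => // s t.
wlog st : s t / s <= t => [H|].
  have [/H//|/ltW/H{}H] := leP s t.
  by move=> sb tb; rewrite distrC [`|f _ - _|]distrC; exact: H.
move=> /andP[as_ _] /andP[_ tb] std.
have := hd 1%N (fun=> s) (fun=> t); rewrite !big_ord1; apply => //.
- by apply/trivIsetP => i j _ _; rewrite !ord1 eqxx.
- by apply: le_lt_trans std; exact: ler_norm.
Qed.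

Lemma max0_lipschitz (s t : R) : `|Num.max 0 s - Num.max 0 t| <= `|s - t|.
Proof.
have [s0|s0] := leP s 0; have [t0|t0] := leP t 0.
- by rewrite subrr normr0.
- by rewrite sub0r normrN gtr0_norm// ler0_norm; lra.
- by rewrite subr0 gtr0_norm// ger0_norm; lra.
- by [].
Qed.

Lemma loc_abs_continuous_max0 (V : normedModType R) (f : R -> V) :
  (forall T, 0 <= T -> abs_continuous 0 T f) -> continuous (fun t => f (Num.max 0 t)).
Proof.
move=> fac t; apply/cvgrPdist_lt => e e0.
have T0 : 0 <= Num.max 0 t + 1 by rewrite addr_ge0// le_max lexx.
have [d d0 hd] := abs_continuous_continuous (fac _ T0) e0.
near=> s; rewrite distrC; apply: hd.
- by rewrite le_max lexx/= lerDl.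
- rewrite le_max lexx/= ge_max T0/=.
  have : s < t + 1 by near: s; apply: lt_nbhsl; rewrite ltrDl.
  move=> /ltW/le_trans; apply; rewrite lerD2r.
  by rewrite le_max lexx orbT.
- apply: (@le_lt_trans _ _ `|s - t|).
    exact: max0_lipschitz.
  rewrite distrC; near: s; exact: (@cvgr_dist_lt _ _ _ _ _ id).
Unshelve. all: by end_near. Qed.

Lemma C1_lipschitz f g T : continuous f -> continuous g ->
  (forall t, 0 < t -> is_derive t 1 f (g t)) -> 0 <= T ->
  exists2 K, 0 <= K & forall s t, 0 <= s -> s <= t -> t <= T -> `|f t - f s| <= K * (t - s).
Proof.
move=> cf cg dfg T0.
have [c _ hc] : exists2 c, c \in `[0, T] & forall t, t \in `[0, T] -> `|g t| <= `|g c|.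
  apply: (@EVT_max _ (fun t => `|g t|)) => //; apply: continuous_subspaceT => x.
  by apply: cvg_norm; exact: cg.
exists `|g c| => // s t s0 st tT; rewrite mulrBr.
apply: (@is_derive_le f g (fun x => `|g c| * x) (fun=> `|g c|)) => //.
- by move=> x; apply: cvgMr; exact: cvg_id.
- by move=> x /andP[sx xt]; apply: dfg; exact: le_lt_trans sx.
- move=> x _; have : is_derive x 1 (fun y : R => `|g c| * y) (`|g c| *: 1) by apply: is_deriveZ.
  by rewrite [_ *: _]mulr1.
- move=> x /andP[sx xt]; apply: hc; rewrite in_itv/= (le_trans s0 (ltW sx))/=.
  exact: le_trans (ltW xt) tT.
Qed.

(** The difference of [f] and [prim g] is absolutely continuous, as [prim g] is Lipschitz on compact
    intervals, and its derivative is zero almost everywhere. This is how an almost everywhere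
    equation becomes an integral equation. *)
Lemma ac_prim f g : continuous g -> (forall T, 0 <= T -> abs_continuous 0 T (f : R -> R^o)) ->
  {ae mu, forall t, 0 < t -> is_derive t 1 f (g t)} ->
  forall t, 0 <= t -> f t = f 0 + prim g t.
Proof.
move=> cg fac dfg t t0.
have dprim (s : R) : 0 < s -> is_derive s 1 (prim g) (g s) by exact: prim_derive.
have [K K0 hK] := C1_lipschitz (prim_continuous cg) cg dprim t0.
have : f t + -1 * prim g t = f 0 + -1 * prim g 0.
  apply: (@null_derive_cst _ 0 t (fun s => f s + -1 * prim g s)) => //.
    apply: abs_continuousD; first exact: fac.
    apply: (@lipschitz_abs_continuous R^o _ _ K) => s r s0 sr rt.
    by rewrite -mulrBr normrM normrN1 mul1r; exact: hK.
  apply: aeS dfg => s dfs /andP[s0 _].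
  suff : is_derive s 1 (fun r => f r + -1 * prim g r) (g s + -1 *: g s) by rewrite scaleN1r subrr.
  by apply: is_deriveD; [exact: dfs s0|apply: is_deriveZ; exact: dprim].
rewrite (prim_le0 _ (lexx 0)); lra.
Qed.

End primitives.

(** * Column vectors with the maximum norm: coordinates and compactness *)

Section column_vectors.
Context {R : realType} {m : nat}.
Implicit Types (v : 'cV[R]_m.+1).

Lemma normr_coord v i : `|v i 0| <= `|v|.
Proof. by rewrite [leRHS]/Num.Def.normr/= mx_normrE (le_bigmax _ _ (i, 0)). Qed.

Lemma normr_le_coord v (K : R) : (forall i, `|v i 0| <= K) -> `|v| <= K.
Proof.
move=> vK; have K0 : 0 <= K by apply: le_trans (vK 0).
rewrite [leLHS]/Num.Def.normr/= mx_normrE bigmax_le// => -[i j] _ /=.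
by rewrite ord1.
Qed.

Lemma cvg_coordP (T : Type) (G : set_system T) (FG : Filter G)
    (x : T -> 'cV[R]_m.+1) v :
  x @ G --> v <-> forall i, x t i 0 @[t --> G] --> v i 0.
Proof.
split=> [xv i|xv].
  exact: (cvg_comp _ (fun w : 'cV[R]_m.+1 => w i 0) xv (@coord_continuous _ _ _ i 0 v)).
apply/cvgrPdist_le => e e0; near=> t.
apply: normr_le_coord => i; rewrite !mxE.
by move: i; near: t; apply: filter_forall => i; exact: ((cvgrPdist_le _ _).1 (xv i)).
Unshelve. all: by end_near. Qed.

Lemma is_derive_coord (x : R -> 'cV[R]_m.+1) (t : R) v i :
  is_derive t 1 x v -> is_derive t 1 (fun s => x s i 0) (v i 0).
Proof.
move=> /is_derive_cvg/cvg_coordP/(_ i) H.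
apply: cvg_is_derive.
by apply: cvg_trans H; apply: near_eq_cvg; apply: nearW => h; rewrite !mxE.
Qed.

Lemma is_derive_col (x : R -> 'cV[R]_m.+1) (t : R) v :
  (forall i, is_derive t 1 (fun s => x s i 0) (v i 0)) -> is_derive t 1 x v.
Proof.
move=> H; apply: cvg_is_derive; apply/cvg_coordP => i; have := is_derive_cvg (H i).
by apply: cvg_trans; apply: near_eq_cvg; apply: nearW => h; rewrite !mxE.
Qed.

(** Compactness is carried over from row vectors by transposition, which is continuous and preserves
    the maximum norm. *)
Lemma compact_closed_ball (r : R) : compact [set v : 'cV[R]_m.+1 | `|v| <= r].
Proof.
have cT : continuous (trmx : 'rV[R]_m.+1 -> 'cV[R]_m.+1).
  move=> x; apply/(cvg_coordP (nbhs_filter x)) => i.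
  by under eq_fun do rewrite mxE; rewrite mxE; exact: (@coord_continuous R _ _ 0 i).
have nT (v : 'rV[R]_m.+1) : `|v^T| = `|v|.
  rewrite /Num.Def.normr/= !mx_normrE; apply/eqP; rewrite eq_le; apply/andP; split.
    by apply: bigmax_le => [|[i j] _] /=; rewrite ?mxE ?(le_bigmax _ _ (j, i))//; exact: bigmax_ge_id.
  apply: bigmax_le => [|[i j] _] /=; first exact: bigmax_ge_id.
  by have := le_bigmax 0 (fun ij => `|v^T ij.1 ij.2|) (j, i); rewrite /= mxE.
rewrite (_ : [set v : 'cV[R]_m.+1 | _] = trmx @` [set v : 'rV[R]_m.+1 | `|v| <= r]).
  apply: continuous_compact; first exact: continuous_subspaceT.
  apply: bounded_closed_compact.
    by exists r; rewrite num_real; split => // x /ltW rx v /= /le_trans; exact.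
  exact: (closed_comp (fun x _ => @norm_continuous _ _ x) (@closed_le _ r)).
apply/seteqP; split => [v /= vr|_ [v /= vr <-]]; last by rewrite nT.
by exists v^T; [rewrite -nT trmxK|exact: trmxK].
Qed.

Lemma continuous_bounded_ball (G : 'cV[R]_m.+1 -> R) (r : R) : continuous G ->
  exists M : R, forall v, `|v| <= r -> `|G v| <= M.
Proof.
move=> cG; have [r0|r0] := ltP r 0.
  by exists 0 => v /le_lt_trans/(_ r0); rewrite normr_lt0.
have [] := @compact_EVT_max 'cV[R]_m.+1 R (fun v => `|G v|) [set v : 'cV[R]_m.+1 | `|v| <= r].
- by exists 0; rewrite /= normr0.
- exact: compact_closed_ball.
- by apply: continuous_subspaceT => v; exact: cvg_norm (cG v).
move=> c _ hc; exists (`|G c|) => v vr; apply: hc; exact: mem_set.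
Qed.

Lemma continuous_pos_sphere (G : 'cV[R]_m.+1 -> R) (r : R) : continuous G -> 0 < r ->
  (forall v, v != 0 -> 0 < G v) -> exists2 c, 0 < c & forall v, `|v| = r -> c <= G v.
Proof.
move=> cG r0 G0.
have cn : continuous (fun v : 'cV[R]_m.+1 => `|v|) by exact: norm_continuous.
have [] := @compact_EVT_min _ _ G ([set v : 'cV[R]_m.+1 | `|v| <= r] `&` [set v : 'cV[R]_m.+1 | r <= `|v|]).
- exists (const_mx r) => /=.
  have -> : `|const_mx r : 'cV[R]_m.+1| = r.
    apply/eqP; rewrite eq_le; apply/andP; split.
      by apply: normr_le_coord => i; rewrite mxE gtr0_norm.
    by have := normr_coord (const_mx r) 0; rewrite mxE gtr0_norm.
  by rewrite lexx.
- apply: compact_closedI; first exact: compact_closed_ball.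
  exact: (closed_comp (fun x _ => cn x) (@closed_ge _ r)).
- exact: continuous_subspaceT.
move=> c; rewrite inE => -[/= c1 c2] hc; exists (G c).
  by apply: G0; rewrite -normr_gt0; exact: lt_le_trans c2.
by move=> v vr; apply: hc; rewrite inE/= vr lexx.
Qed.

End column_vectors.

(** * Signed powers and convexity *)

Section signed_power.
Context {R : realType}.
Implicit Types (a r q : R).

Lemma continuous_norm_powR r : 0 < r -> continuous (fun a : R => `|a| `^ r).
Proof.
move=> r0 a; have [->|a0] := eqVneq a 0.
  rewrite /continuous_at normr0 powR0 ?gt_eqF//.
  apply/cvgrPdist_lt => e e0; have /cvgrPdist_lt/(_ e e0)[d /= d0 hd] := powR_cvg0 r0.
  exists d => //= x; rewrite !sub0r !normrN => xd.
  have [->|x0] := eqVneq x 0; first by rewrite normr0 powR0 ?gt_eqF// normr0.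
  have := hd `|x|; rewrite /ball_/= !sub0r !normrN normr_id normr_gt0; apply => //.
  by move: xd; rewrite /ball_/= sub0r normrN.
apply: (@continuous_comp _ _ _ (fun a : R => `|a|) (fun b => b `^ r)).
  exact: norm_continuous.
apply/differentiable_continuous/derivable1_diffP/derivable_powR.
by rewrite in_itv/= andbT normr_gt0.
Qed.

(** [Num.sg] jumps at 0; positive and negative parts do not, so this form makes continuity
    visible. *)
Lemma spowE a r : r != 0 -> spow a r = `|Num.max 0 a| `^ r - `|Num.max 0 (- a)| `^ r.
Proof.
move=> r0; rewrite /spow; case: (ltgtP 0 a) => [a0|a0|<-].
- by rewrite gtr0_sg// mulr1 max_l ?oppr_le0 ?ltW// normr0 powR0// subr0.
- by rewrite ltr0_sg// mulrN1 normr0 max_r ?oppr_ge0 ?ltW// normrN powR0// sub0r.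
- by rewrite sgr0 mulr0 oppr0 maxxx subrr.
Qed.

Lemma continuous_spow r : 0 < r -> continuous (spow ^~ r : R -> R).
Proof.
move=> r0; rewrite (_ : spow ^~ r = fun a => `|Num.max 0 a| `^ r - `|Num.max 0 (- a)| `^ r).
  move=> a; apply: cvgB.
    apply: (@continuous_comp _ _ _ (fun a : R => Num.max 0 a) (fun b => `|b| `^ r)).
      by apply: continuous_max; [exact: cvg_cst|exact: cvg_id].
    exact: continuous_norm_powR.
  apply: (@continuous_comp _ _ _ (fun a : R => Num.max 0 (- a)) (fun b => `|b| `^ r)).
    by apply: continuous_max; [exact: cvg_cst|exact: opp_continuous].
  exact: continuous_norm_powR.
by apply/funext => a; rewrite spowE// gt_eqF.
Qed.

Lemma normr_spow a r : r != 0 -> `|spow a r| = `|a| `^ r.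
Proof.
move=> r0; rewrite /spow normrM norm_powR ?normr_ge0// normr_id normr_sg.
by have [->|] := eqVneq a 0; rewrite ?mulr1// mulr0 normr0 powR0.
Qed.

Lemma sgr_spow a r : Num.sg (spow a r) = Num.sg a.
Proof.
rewrite /spow sgrM sgr_id; have [->|a0] := eqVneq a 0; first by rewrite sgr0 mulr0.
by rewrite gtr0_sg ?mul1r// powR_gt0// normr_gt0.
Qed.

Lemma spowK r : r != 0 -> cancel (spow ^~ r : R -> R) (spow ^~ r^-1).
Proof.
move=> r0 a; rewrite {1}/spow sgr_spow normr_spow// -powRrM mulfV// powRr1//.
by rewrite mulrC -numEsg.
Qed.

Lemma is_derive_norm_powR q a : 1 < q ->
  is_derive a 1 (fun b : R => `|b| `^ q / q) (spow a (q - 1)).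
Proof.
move=> q1; have q0 : 0 < q by rewrite (lt_trans ltr01).
have qn0 : q != 0 by rewrite gt_eqF.
have pos (b : R) : 0 < b -> is_derive b 1 (fun x : R => q^-1 *: x `^ q) (b `^ (q - 1)).
  move=> b0; have := is_deriveZ q^-1 (is_derive1_powR q b0).
  by rewrite [_ *: (_ * _)]mulrA mulVf// mul1r.
case: (ltgtP a 0) => [a0|a0|->].
- rewrite /spow ltr0_sg// ltr0_norm//.
  have H : is_derive a 1 (fun x : R => q^-1 *: (- x) `^ q) ((- a) `^ (q - 1) * -1).
    have Na : 0 < - a by rewrite oppr_gt0.
    have := @is_derive1_comp _ (fun x : R => q^-1 *: x `^ q) (fun x => - x) a _ _ (pos _ Na) _.
    by apply; apply: is_deriveN.
  apply: near_eq_is_derive H; near=> x; rewrite ltr0_norm; first by rewrite mulrC.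
  by near: x; exact: lt_nbhsl.
- rewrite /spow gtr0_sg// mulr1 gtr0_norm//.
  apply: near_eq_is_derive (pos _ a0); near=> x; rewrite gtr0_norm; first by rewrite mulrC.
  by near: x; exact: lt_nbhsr.
(* At 0 the difference quotient has absolute value [|h| ^ (q - 1) / q], which tends to 0 because
   [1 < q]. *)
- rewrite /spow sgr0 mulr0.
  apply: cvg_is_derive; apply/cvgrPdist_lt => e e0.
  have := @continuous_norm_powR (q - 1) _ 0; rewrite subr_gt0 => /(_ q1).
  rewrite /continuous_at normr0 powR0; last by rewrite subr_eq0 gt_eqF.
  move=> /cvgrPdist_lt/(_ e e0)[d /= d0 hd]; exists d => //= h hd' h0.
  have := hd h hd'; rewrite !sub0r !normrN addr0 [_%:A]mulr1 powR0// mul0r subr0.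
  apply: le_lt_trans; rewrite normrM normfV normrM normfV norm_powR// normr_id.
  rewrite norm_powR// normr_id -mulr_powRB1//.
  rewrite !mulrA mulVf ?normr_eq0// mul1r (gtr0_norm q0).
  by rewrite ler_piMr ?powR_ge0// invf_le1// ltW.
Unshelve. all: by end_near. Qed.

End signed_power.

(** * Convex functions and the running cost [F] *)

Section convex.
Context {R : realType} {V : lmodType R}.

Definition is_convex (G : V -> R) := forall x y (t : R), 0 <= t <= 1 ->
  G (t *: x + (1 - t) *: y) <= t * G x + (1 - t) * G y.

(* A bound uniform in the step e, as needed for dominated convergence. *)
Lemma convex_slope_bound (G : V -> R) x y (e : R) : is_convex G -> 0 < e <= 1 ->
  `|e^-1 * (G (x + e *: y) - G x)| <= `|G (x + y) - G x| + `|G x - G (x - y)|.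
Proof.
move=> cG /andP[e0 e1].
have up : G (x + e *: y) - G x <= e * (G (x + y) - G x).
  have := cG (x + y) x e; rewrite (ltW e0) e1 => /(_ isT).
  by rewrite scalerDr scalerBl scale1r [(_ + _) + (x - _)]addrC addrA subrK; lra.
have e1' : 0 < 1 + e by rewrite addr_gt0.
(* The lower bound comes from writing [x] as the convex combination of [x + e *: y] and [x - y] with
   weights [1 / (1 + e)] and [e / (1 + e)]. *)
have lo : e * (G x - G (x - y)) <= G (x + e *: y) - G x.
  have := cG (x + e *: y) (x - y) (1 + e)^-1.
  rewrite invr_ge0 (ltW e1') invf_le1// lerDl (ltW e0) => /(_ isT).
  have -> : 1 - (1 + e)^-1 = (1 + e)^-1 * e.
    by rewrite -{1}(mulVf (lt0r_neq0 e1')) -[X in _ - X]mulr1 -mulrBr addrAC subrr add0r.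
  have -> : (1 + e)^-1 *: (x + e *: y) + ((1 + e)^-1 * e) *: (x - y) = x.
    rewrite -scalerA -scalerDr scalerBr addrACA subrr addr0.
    by rewrite -[X in _ *: (X + _)]scale1r -scalerDl scalerA mulVf ?scale1r// gt_eqF.
  rewrite -mulrA -mulrDr ler_pdivlMl//; lra.
rewrite normrM (gtr0_norm (_ : 0 < e^-1)) ?invr_gt0// ler_pdivrMl// ler_norml.
have := ler_norm (G (x + y) - G x); have := ler_norm (- (G x - G (x - y))).
have := normr_ge0 (G (x + y) - G x); have := normr_ge0 (G x - G (x - y)).
rewrite normrN => n1 n2 n3 n4.
apply/andP; split.
  apply: le_trans lo; rewrite -mulrN ler_pM2l//; lra.
by apply: le_trans up _; rewrite ler_pM2l//; lra.
Qed.

End convex.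

Section convex_running_cost.
Context {R : realType} {n : nat} (F : 'cV[R]_n.+1 -> R).

Lemma contdiff_continuous : contdiff F -> continuous F.
Proof. by move=> [dF _] x; exact: differentiable_continuous (dF x). Qed.

Lemma gradient_cvg : contdiff F -> forall x y,
  h^-1 * (F (x + h *: y) - F x) @[h --> 0^'] --> \sum_i gradient F x i 0 * y i 0.
Proof.
move=> [dF _] x y.
have -> : \sum_i gradient F x i 0 * y i 0 = 'D_y (F : 'cV[R]_n.+1 -> R^o) x.
  rewrite (deriveE _ (dF x)) [in RHS](matrix_sum_delta y).
  under [in RHS]eq_bigr do rewrite big_ord1.
  rewrite linear_sum; apply: eq_bigr => i _; rewrite linearZ/= !mxE -deriveE// mulrC.
  by [].
have : is_derive x y (F : 'cV[R]_n.+1 -> R^o) ('D_y (F : 'cV[R]_n.+1 -> R^o) x).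
  by apply: DeriveDef => //; exact: diff_derivable.
move=> /is_derive_cvg; apply: cvg_trans; apply: near_eq_cvg; apply: nearW => h.
by rewrite [x + _]addrC.
Qed.

Lemma convex_function_is_convex : convex_function [set: 'cV[R]_n.+1] F -> is_convex F.
Proof.
move=> cF x y t /andP[t0 t1].
have := cF (Itv01 t0 t1) x y; rewrite !inE => /(_ I I).
by rewrite convRE.
Qed.

Lemma positive_definite_ge0 : positive_definite F -> forall x, 0 <= F x.
Proof. by move=> [F0 Fp] x; have [->|/Fp/ltW//] := eqVneq x 0; rewrite F0. Qed.

(** The origin minimizes [F], hence its restriction to each coordinate axis. This makes the source
    term of the adjoint equation small where the state is small. *)
Lemma gradient0 : contdiff F -> positive_definite F -> gradient F 0 = 0.
Proof.
move=> cF pF; apply/colP => i; rewrite !mxE.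
pose d : 'cV[R]_n.+1 := delta_mx i 0.
have df (t : R) : is_derive t 1 (fun h : R => F (h *: d)) (\sum_j gradient F (t *: d) j 0 * d j 0).
  apply: cvg_is_derive; have := @gradient_cvg cF (t *: d) d.
  apply: cvg_trans; apply: near_eq_cvg; apply: nearW => h.
  by rewrite [h *: 1]mulr1 scalerDl [_ *: d + _]addrC.
have d0 : is_derive (0 : R) 1 (fun h : R => F (h *: d)) 0.
  apply: (@derive1_at_min R _ (-1) 1) => //.
  - by rewrite in_itv/=; apply/andP; split; lra.
  - by move=> t _; rewrite scale0r pF.1; exact: positive_definite_ge0.
have := @derive_val _ _ _ _ _ _ _ (df 0); rewrite (@derive_val _ _ _ _ _ _ _ d0) scale0r.
rewrite (bigD1 i)//= big1 => [|j ji]; last by rewrite !mxE (negPf ji) mulr0.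
by rewrite !mxE !eqxx mulr1 addr0 => <-.
Qed.

(** [c * r] is a positive lower bound of [F] on the sphere of radius [r]. Outside the ball,
    convexity along the segment from 0 through the sphere to [x] gives linear growth; inside, the
    left side is nonpositive. Every [r] is allowed, so the loss [r] can later be made as small as
    desired. *)
Lemma convex_coercive : contdiff F -> is_convex F -> positive_definite F ->
  forall r, 0 < r -> exists2 c, 0 < c & forall x, c * (`|x| - r) <= F x.
Proof.
move=> cF vF pF r r0.
have [c c0 hc] := continuous_pos_sphere (contdiff_continuous cF) r0 pF.2.
exists (c / r); first by rewrite divr_gt0.
move=> x; have [xr|xr] := leP `|x| r.
  apply: le_trans (positive_definite_ge0 pF x).
  by rewrite mulr_ge0_le0// ?subr_le0// divr_ge0// ltW.
have x0 : 0 < `|x| by exact: lt_trans xr.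
have := vF x 0 (r / `|x|); rewrite divr_ge0 ?(ltW r0)// ler_pdivrMr// mul1r (ltW xr) => /(_ isT).
rewrite scaler0 addr0 pF.1 mulr0 addr0 => H.
have := hc ((r / `|x|) *: x).
rewrite normrZ gtr0_norm ?divr_gt0// divfK ?gt_eqF// => /(_ erefl) H2.
have {H H2} := le_trans H2 H; rewrite mulrC -ler_pdivrMr ?divr_gt0//.
apply: le_trans; rewrite invf_div -mulrA ler_pM2l// mulrC ler_pM2r ?invr_gt0//.
by rewrite lerBlDr lerDl ltW.
Qed.

End convex_running_cost.

(** * Polynomial test pairs *)

Section poly_tests.
Context {R : realType} {n : nat}.
Local Notation mu := (@lebesgue_measure R).
Implicit Types (phi : {poly R}) (b t : R).

Lemma jordanE (v : 'cV[R]_n.+1) (i : 'I_n.+1) :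
  (jordan n *m v) i 0 = if (i < n)%N then v (inord i.+1) 0 else 0.
Proof.
rewrite mxE; case: ltnP => i0.
  rewrite (bigD1 (inord i.+1))//= big1 ?addr0 => [|j ji]; rewrite !mxE.
    by rewrite inordK// eqxx mul1r.
  rewrite [_ == _](_ : _ = false) ?mul0r//; apply: contraNF ji => /eqP ji.
  by apply/eqP/val_inj; rewrite /= inordK.
rewrite big1// => j _; rewrite !mxE; case: eqP => [ji|]; rewrite ?mul0r//.
by have := ltn_ord j; rewrite ji !ltnS ltnNge i0.
Qed.

Lemma elastE (i : 'I_n.+1) : elast n i 0 = (i == n :> nat)%:R :> R.
Proof. by rewrite mxE eqxx andbT -val_eqE. Qed.

Lemma trjordanE (v : 'cV[R]_n.+1) (i : 'I_n.+1) :
  ((jordan n)^T *m v) i 0 = if (0 < i)%N then v (inord i.-1) 0 else 0.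
Proof.
rewrite mxE; case: ltnP => i0.
  have i1 : (i.-1 < n.+1)%N by exact: leq_ltn_trans (leq_pred i) (ltn_ord i).
  rewrite (bigD1 (inord i.-1))//= big1 ?addr0 => [|j ji]; rewrite !mxE.
    by rewrite inordK// prednK// eqxx mul1r.
  rewrite [_ == _](_ : _ = false) ?mul0r//; apply: contraNF ji => /eqP ->.
  by apply/eqP/val_inj; rewrite /= inordK.
rewrite big1// => j _; rewrite !mxE.
by case: eqP => [ji|]; rewrite ?mul0r//; rewrite ji in i0.
Qed.

Lemma root_derivn phi b k i : ('X - b%:P) ^+ k %| phi -> (i < k)%N -> phi^`(i).[b] = 0.
Proof.
elim: i k phi => [|i IH] [|k] phi // hk ik.
  have /dvdpP[s ->] := hk.
  by rewrite derivn0 hornerM horner_exp !hornerE subrr expr0n mulr0.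
rewrite derivSn; apply: (IH k) => //; have /dvdpP[s ->] := hk.
rewrite derivM deriv_exp derivXsubC mul1r /= dvdp_add//.
  by rewrite dvdp_mull// dvdp_exp2l.
by rewrite dvdp_mull// -mulr_natr dvdp_mulr.
Qed.

Lemma is_derive_horner phi t : is_derive t 1 (horner phi) (phi^`()).[t].
Proof. by apply: DeriveDef; [exact: derivable_horner|rewrite derivE derive1E]. Qed.

(* The derivatives of phi up to order n vanish at b when ('X - b)^(n+1) | phi,
   so Num.min t b continues the state by 0 after b. *)
Definition test_state phi b t : 'cV[R]_n.+1 := \col_i phi^`(i).[Num.min t b].
Definition test_control phi b t : R := if t <= b then phi^`(n.+1).[t] else 0.

(** Before [b] the state is the chain of successive derivatives, after [b] it is 0. The control may
    jump at [b], so that time is excluded. *)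
Lemma test_state_derive phi b t : ('X - b%:P) ^+ n.+1 %| phi -> t != b ->
  is_derive t 1 (test_state phi b)
    (jordan n *m test_state phi b t + test_control phi b t *: elast n).
Proof.
move=> hphi; rewrite neq_lt => /orP[tb|bt]; apply: is_derive_col => i.
  have : is_derive t 1 (horner phi^`(i)) (phi^`(i)^`()).[t] by exact: is_derive_horner.
  rewrite -derivnS; have -> : (phi^`(i.+1)).[t] =
     (jordan n *m test_state phi b t + test_control phi b t *: elast n) i 0.
    rewrite mxE jordanE [X in _ + X]mxE elastE mxE /test_control (ltW tb) min_l ?(ltW tb)//.
    have := ltn_ord i; rewrite ltnS leq_eqVlt => /orP[/eqP ->|h].
      by rewrite ltnn eqxx mulr1 add0r.
    by rewrite h (ltn_eqF h) mulr0 addr0 inordK.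
  apply: near_eq_is_derive; near=> s; rewrite mxE min_l//.
  by apply: ltW; near: s; exact: lt_nbhsl.
have -> : (jordan n *m test_state phi b t + test_control phi b t *: elast n) i 0 = 0.
  have -> : test_state phi b t = 0.
    by apply/colP => j; rewrite !mxE min_r ?ltW//; apply: root_derivn hphi _.
  by rewrite mulmx0 /test_control leNgt bt/= scale0r add0r mxE.
have : is_derive t 1 (fun=> 0 : R) 0 by exact: is_derive_cst.
apply: near_eq_is_derive; near=> s; rewrite mxE min_r ?(root_derivn hphi)//.
by apply: ltW; near: s; exact: lt_nbhsr.
Unshelve. all: by end_near. Qed.

(** Unlike the polynomial pairs themselves, this class is stable under linear combinations of pairs
    with different end times. Boundedness and compact support give finite perturbed costs, the
    Lipschitz bound gives absolute continuity, and the equation is only almost everywhere because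
    controls jump at end times. *)
Definition is_test (v : R -> R) (y : R -> 'cV[R]_n.+1) := [/\ measurable_fun setT v,
  exists M : R, forall t, 0 <= t -> `|v t| <= M /\ `|y t| <= M,
  exists T : R, forall t, T < t -> v t = 0 /\ y t = 0,
  exists K : R, forall s t, 0 <= s -> s <= t -> `|y t - y s| <= K * (t - s) &
  {ae mu, forall t, 0 < t -> is_derive t 1 y (jordan n *m y t + v t *: elast n)}].

Lemma is_test0 : is_test (fun=> 0) (fun=> 0).
Proof.
split.
- exact: measurable_cst.
- by exists 0 => t _; rewrite !normr0.
- by exists 0 => t _.
- by exists 0 => s t _ _; rewrite subrr normr0 mul0r.
- by apply: aeW => t _; rewrite mulmx0 scale0r addr0; exact: is_derive_cst.
Qed.

Lemma is_test_lin a v v' y y' : is_test v y -> is_test v' y' ->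
  is_test (fun t => a * v t + v' t) (fun t => a *: y t + y' t).
Proof.
move=> [mv [M hM] [T hT] [K hK] dy] [mv' [M' hM'] [T' hT'] [K' hK'] dy'].
split.
- by apply: measurable_funD => //; apply: measurable_funM => //; exact: measurable_cst.
- exists (`|a| * M + M') => t t0; have [h1 h2] := hM t t0; have [h3 h4] := hM' t t0.
  split; apply: le_trans (ler_normD _ _) _; apply: lerD => //.
    by rewrite normrM ler_wpM2l.
  by rewrite normrZ ler_wpM2l.
- exists (Num.max T T') => t; rewrite gt_max => /andP[/hT[-> ->] /hT'[-> ->]].
  by rewrite mulr0 scaler0 !addr0.
- exists (`|a| * K + K') => s t s0 st; rewrite opprD addrACA -scalerBr mulrDl.
  apply: le_trans (ler_normD _ _) _; apply: lerD; last exact: hK'.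
  by rewrite normrZ -mulrA ler_wpM2l// hK.
- apply: aeS2 dy dy' => t dy dy' t0.
  have -> : jordan n *m (a *: y t + y' t) + (a * v t + v' t) *: elast n =
    a *: (jordan n *m y t + v t *: elast n) + (jordan n *m y' t + v' t *: elast n).
    by rewrite mulmxDr -scalemxAr scalerDl scalerDr scalerA addrACA.
  by apply: is_deriveD; [apply: is_deriveZ; exact: dy|exact: dy'].
Qed.

Lemma is_test_sum (I : Type) (r : seq I) (c : I -> R) (v : I -> R -> R)
    (y : I -> R -> 'cV[R]_n.+1) : (forall i, is_test (v i) (y i)) ->
  is_test (fun t => \sum_(i <- r) c i * v i t) (fun t => \sum_(i <- r) c i *: y i t).
Proof.
move=> H; elim: r => [|i r IH].
  by under eq_fun do rewrite big_nil; under [X in is_test _ X]eq_fun do rewrite big_nil; exact: is_test0.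
under eq_fun do rewrite big_cons; under [X in is_test _ X]eq_fun do rewrite big_cons.
exact: is_test_lin (H i) IH.
Qed.

Lemma horner_bounded phi b : 0 <= b -> exists2 M : R, 0 <= M & forall t, 0 <= t <= b -> `|phi.[t]| <= M.
Proof.
move=> b0; have [] := @EVT_max R (fun t => `|phi.[t]|) 0 b b0.
  by apply: continuous_subspaceT => t; apply: cvg_norm; exact: continuous_horner.
by move=> c _ hc; exists (`|phi.[c]|) => // t tb; apply: hc; rewrite in_itv.
Qed.

Lemma horner_lipschitz phi b : 0 <= b -> exists2 K : R, 0 <= K &
  forall s t : R, 0 <= s -> s <= t -> t <= b -> `|phi.[t] - phi.[s]| <= K * (t - s).
Proof.
apply: (@C1_lipschitz _ (horner phi) (horner phi^`())); try exact: continuous_horner.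
Qed.

Lemma min_lipschitz (s t b : R) : s <= t ->
  Num.min s b <= Num.min t b /\ Num.min t b - Num.min s b <= t - s.
Proof. by move=> st; case: (leP s b) => sb; case: (leP t b) => tb; split; lra. Qed.

Lemma test_pair phi b : 0 <= b -> ('X - b%:P) ^+ n.+1 %| phi ->
  is_test (test_control phi b) (test_state phi b).
Proof.
move=> b0 hphi; split.
- rewrite (_ : test_control phi b = fun t => phi^`(n.+1).[t] * \1_(`]-oo, b]) t).
    apply: measurable_funM; first by apply: continuous_measurable_fun; exact: continuous_horner.
    exact: measurable_indic.
  apply/funext => t; rewrite /test_control indicE mem_setE in_itv/=.
  by case: ifP; rewrite ?mulr1 ?mulr0.
- have [Mv Mv0 hMv] := horner_bounded phi^`(n.+1) b0.
  have /fin_all_exists[M hM] : forall i : 'I_n.+1, exists M : R,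
      0 <= M /\ forall t, 0 <= t <= b -> `|phi^`(i).[t]| <= M.
    by move=> i; have [M M0 hM] := horner_bounded phi^`(i) b0; exists M.
  have M0 i : 0 <= M i by have [] := hM i.
  exists (Mv + \sum_i M i) => t t0; split.
    apply: (@le_trans _ _ Mv); last by rewrite lerDl sumr_ge0.
    by rewrite /test_control; case: ifP => tb; [apply: hMv; rewrite t0|rewrite normr0].
  apply: (@le_trans _ _ (\sum_i M i)); last by rewrite lerDr.
  apply: normr_le_coord => i; rewrite mxE (bigD1 i)//= ler_wpDr ?sumr_ge0//.
  by apply: (hM i).2; rewrite le_min t0 b0 ge_min lexx orbT.
- exists b => t bt; rewrite /test_control leNgt bt; split => //.
  by apply/colP => i; rewrite !mxE min_r ?ltW//; exact: root_derivn hphi _.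
- have /fin_all_exists[K hK] : forall i : 'I_n.+1, exists K : R, 0 <= K /\
      forall s t, 0 <= s -> s <= t -> t <= b -> `|phi^`(i).[t] - phi^`(i).[s]| <= K * (t - s).
    by move=> i; have [K K0 hK] := horner_lipschitz phi^`(i) b0; exists K.
  have K0 i : 0 <= K i by have [] := hK i.
  exists (\sum_i K i) => s t s0 st; apply: normr_le_coord => i; rewrite !mxE.
  have [m1 m2] := min_lipschitz b st.
  apply: (@le_trans _ _ (K i * (Num.min t b - Num.min s b))).
    by apply: (hK i).2 => //; rewrite ?le_min ?s0// ge_min lexx orbT.
  apply: ler_pM => //; first by rewrite subr_ge0.
  by rewrite (bigD1 i)//= lerDl sumr_ge0.
- exists [set b]; split => //; first exact: lebesgue_measure_set1.
  by move=> t /= H; apply: contrapT => tb; apply: H => _; apply: test_state_derive => //; exact/eqP.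
Qed.

(** Hermite interpolation at the nodes 0 and 1. The pairs built from these polynomials form a basis
    from which a steering pair is assembled linearly in the initial state, which makes all steering
    bounds proportional to its norm. *)
Lemma steering_polys : exists phi : 'I_n.+1 -> {poly R}, forall j,
  ('X - 1%:P) ^+ n.+1 %| phi j /\ forall i : 'I_n.+1, (phi j)^`(i).[0] = (i == j)%:R.
Proof.
suff /fin_all_exists : forall j : 'I_n.+1, exists phi : {poly R},
  ('X - 1%:P) ^+ n.+1 %| phi /\ forall i : 'I_n.+1, phi^`(i).[0] = (i == j)%:R by [].
move=> j.
(* Bezout gives v * ('X - 1)^(n+1) = 1 modulo 'X^(n+1); multiplying by 'X^j / j!
   prescribes the derivatives at 0 and keeps the zero of order n + 1 at 1. *)
have cop : coprimep (('X - 0%:P) ^+ n.+1 : {poly R}) (('X - 1%:P) ^+ n.+1).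
  rewrite coprimep_expl// coprimep_expr// coprimep_XsubC root_XsubC.
  exact: oner_neq0.
have /Bezout_eq1_coprimepP[[u v] /= uv1] := cop.
pose psi : {poly R} := (j`!)%:R^-1 *: 'X^j.
exists (v * ('X - 1%:P) ^+ n.+1 * psi); split.
  by rewrite dvdp_mulr// dvdp_mull.
move=> i; have -> : v * ('X - 1%:P) ^+ n.+1 * psi = psi - u * psi * ('X - 0%:P) ^+ n.+1.
  have -> : v * ('X - 1%:P) ^+ n.+1 = 1 - u * ('X - 0%:P) ^+ n.+1.
    by apply/eqP; rewrite eq_sym subr_eq addrC uv1.
  by rewrite mulrBl mul1r mulrAC.
have E0 : (u * psi * ('X - 0%:P) ^+ n.+1)^`(i).[0] = 0.
  by apply: (@root_derivn _ 0 n.+1) => //; exact: dvdp_mull.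
rewrite derivnB hornerD hornerN E0.
rewrite oppr0 addr0 derivnZ derivnXn hornerZ hornerMn hornerXn.
have [->|ij] := eqVneq i j.
  by rewrite subnn expr0 ffactnn mulVf// pnatr_eq0 -lt0n fact_gt0.
case: (ltngtP i j) => [lt|gt|/val_inj E]; last by rewrite E eqxx in ij.
  by rewrite expr0n subn_eq0 leqNgt lt/= mul0rn mulr0.
by rewrite ffact_small// mulr0n mulr0.
Qed.

Lemma steering_initial (phi : 'I_n.+1 -> {poly R}) (z : 'cV[R]_n.+1) :
  (forall j (i : 'I_n.+1), (phi j)^`(i).[0] = (i == j)%:R) ->
  \sum_j z j 0 *: test_state (phi j) 1 0 = z.
Proof.
move=> hphi; apply/colP => i; rewrite summxE (bigD1 i)//= big1 ?addr0 => [|j ji];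
  rewrite !mxE min_l ?ler01// hphi.
  by rewrite eqxx mulr1.
by rewrite eq_sym (negPf ji) mulr0.
Qed.

End poly_tests.

Arguments test_control {R} n phi b t.
Arguments test_state {R} n phi b t.

(** * Integrability of controls, and trajectories under perturbation *)

Section admissible_controls.
Context {R : realType} {n : nat}.
Local Notation mu := (@lebesgue_measure R).
Local Notation D := (`[0%R, +oo[%classic : set R).

Lemma integrable_dominated (A : set R) (f g : R -> R) : measurable A ->
  measurable_fun A f -> mu.-integrable A (EFin \o g) ->
  (forall t, A t -> `|f t| <= g t) -> mu.-integrable A (EFin \o f).
Proof.
move=> mA mf ig fg; apply: (@le_integrable _ _ _ mu A mA (EFin \o f) (EFin \o g)) => //.
  exact/measurable_EFinP.
by move=> t At /=; rewrite lee_fin (le_trans (fg t At))// ler_norm.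
Qed.

Lemma integrable_bounded (v : R -> R) (M T : R) : measurable_fun D v ->
  (forall t, 0 <= t -> `|v t| <= M) -> (forall t, T < t -> v t = 0) ->
  mu.-integrable D (EFin \o v).
Proof.
move=> mv vM vT; have M0 : 0 <= M by apply: le_trans (vM 0 _).
apply: (@integrable_dominated _ _ ((fun=> M) \_ `[0, T])) => //.
  rewrite -restrict_EFin; apply/integrable_restrict => //.
  rewrite setIidr; last exact: subset_itvl.
  by apply: (@continuous_integrable _ (fun=> M)) => t; exact: cvg_cst.
move=> t /=; rewrite in_itv/= andbT => t0; rewrite patchE; case: ifPn => [_|]; first exact: vM.
by rewrite notin_setE/= in_itv/= t0/= => /negP; rewrite -ltNge => /vT ->; rewrite normr0.
Qed.

Lemma admissible_measurable q u : admissible q u -> measurable_fun D u.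
Proof.
move=> /andP[]; rewrite inE/= => mu_ _.
by apply/measurable_restrictT.
Qed.

Lemma admissible_integrable q u : 1 < q -> admissible q u ->
  mu.-integrable D (EFin \o (fun t : R => `|u t| `^ q)).
Proof.
move=> q1 /(Lfun_integrable (ltW q1)) H; rewrite -[D]setTI.
apply/integrable_restrict => //.
rewrite (_ : _ \_ _ = fun t => (`|(u \_ D) t| `^ q)%:E)//.
apply/funext => t; rewrite !patchE; case: ifP => // _.
by rewrite normr0 powR0// gt_eqF// (lt_trans ltr01).
Qed.

Lemma integrable_lin (A : set R) (f g : R -> R) (a : R) : measurable A ->
  mu.-integrable A (EFin \o f) -> mu.-integrable A (EFin \o g) ->
  mu.-integrable A (EFin \o (fun t => a * f t + g t)).
Proof.
move=> mA fi gi.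
rewrite (_ : _ \o _ = (fun t => a%:E * (EFin \o f) t)%E \+ (EFin \o g))%E//.
by apply: integrableD => //; exact: integrableZl.
Qed.

Lemma Rintegral_lin (A : set R) (f g : R -> R) (a : R) : measurable A ->
  mu.-integrable A (EFin \o f) -> mu.-integrable A (EFin \o g) ->
  \int[mu]_(t in A) (a * f t + g t) = a * (\int[mu]_(t in A) f t) + \int[mu]_(t in A) g t.
Proof.
move=> mA fi gi; rewrite RintegralD//; first by rewrite RintegralZl.
rewrite (_ : EFin \o _ = (fun t => a%:E * (EFin \o f) t)%E)//.
exact: integrableZl.
Qed.

Lemma admissible_lin q u v (a : R) : 1 < q -> admissible q u -> admissible q v ->
  admissible q (fun t => a * v t + u t).
Proof.
move=> q1 hu hv; have q1' : (1%:E <= q%:E)%E by rewrite lee_fin ltW.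
have := (Lfun_submod_closed _ q1').2 a _ _ hv hu.
suff -> : a *: v \_ D + u \_ D = (fun t => a * v t + u t) \_ D by [].
apply/funext => t; rewrite -[LHS]/(a * (v \_ D) t + (u \_ D) t) !patchE.
by case: ifP => // _; rewrite mulr0 addr0.
Qed.

Lemma is_test_admissible q (v : R -> R) (y : R -> 'cV[R]_n.+1) : 1 < q ->
  is_test v y -> admissible q v.
Proof.
move=> q1 [mv [M hM] [T hT] _ _]; have q0 : 0 < q by exact: lt_trans q1.
have M0 : 0 <= M by have [/(le_trans (normr_ge0 _))] := hM 0 (lexx 0).
rewrite /admissible inE; apply/andP; split; rewrite inE/=.
  by apply/(measurable_restrictT _ _).1 => //; exact: measurable_funTS.
have I : mu.-integrable setT (EFin \o ((fun t : R => `|v t| `^ q) \_ D)).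
  rewrite -restrict_EFin; apply/integrable_restrict => //; rewrite setTI.
  apply: (@integrable_bounded (fun t => `|v t| `^ q) (M `^ q) T).
  - apply: (measurableT_comp (measurable_powR _)) => //.
    by apply: measurableT_comp => //; exact: measurable_funTS.
  - move=> t t0; rewrite norm_powR// normr_id ge0_ler_powR ?nnegrE ?(ltW q0)//.
    by have [] := hM t t0.
  - by move=> t /hT[-> _]; rewrite normr0 powR0 ?gt_eqF.
rewrite /finite_norm unlock; apply: poweR_lty.
have := integrable_lty measurableT I; apply: le_lt_trans.
rewrite le_eqVlt; apply/orP; left; apply/eqP/eq_integral => t _.
rewrite /= !patchE; case: ifP => // _.
by rewrite normr0 powR0// gt_eqF.
Qed.

End admissible_controls.

Section trajectories.
Context {R : realType} {n : nat}.
Local Notation mu := (@lebesgue_measure R).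
Local Notation D := (`[0%R, +oo[%classic : set R).
Implicit Types (x y : R -> 'cV[R]_n.+1) (u v : R -> R).

Lemma measurable_max0 (f : R -> R) :
  continuous (fun t : R => f (Num.max 0 t)) -> measurable_fun D f.
Proof.
move=> cf; apply: (@eq_measurable_fun _ _ _ _ D (fun t : R => f (Num.max 0 t))).
  by move=> t; rewrite inE/= in_itv/= andbT => t0; rewrite max_r.
by apply: measurable_funTS; exact: continuous_measurable_fun.
Qed.

Lemma trajectory_continuous (x0 : 'cV[R]_n.+1) u x : trajectory x0 u x ->
  continuous (fun t : R => x (Num.max 0 t)).
Proof. by move=> [_ [xac _]]; exact: loc_abs_continuous_max0. Qed.

Lemma is_test_ac v y (T : R) : is_test v y -> abs_continuous 0 T y.
Proof.
move=> [_ _ _ [K hK] _]; apply: (@lipschitz_abs_continuous _ _ _ _ K) => s t s0 st _.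
exact: hK.
Qed.

Lemma trajectory_lin (x0 : 'cV[R]_n.+1) u x v y (a : R) : trajectory x0 u x -> is_test v y ->
  trajectory (a *: y 0 + x0) (fun t => a * v t + u t) (fun t => a *: y t + x t).
Proof.
move=> [x00 [xac dx]] hy; split; first by rewrite x00.
split.
  move=> T T0; apply: abs_continuousD; last exact: xac.
  apply: abs_continuous_dominated (is_test_ac T hy) (_ : forall s t, _ -> _ -> _ -> _ <= `|a| * _).
  by move=> s t _ _ _; rewrite -scalerBr normrZ.
have [_ _ _ _ dy] := hy.
apply: aeS2 dy dx => t dy dx t0.
have -> : jordan n *m (a *: y t + x t) + (a * v t + u t) *: elast n =
    a *: (jordan n *m y t + v t *: elast n) + (jordan n *m x t + u t *: elast n).
  by rewrite mulmxDr -scalemxAr scalerDl scalerDr scalerA addrACA.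
by apply: is_deriveD; [apply: is_deriveZ; exact: dy|exact: dx].
Qed.

Lemma is_test_trajectory v y : is_test v y -> trajectory (y 0) v y.
Proof. by move=> hy; split=> //; split; [move=> T _; exact: is_test_ac hy|case: hy]. Qed.

End trajectories.

(** * First variation of the cost *)

Section cost_integrability.
Context {R : realType} {n : nat} (q : R) (F : 'cV[R]_n.+1 -> R).
Context (q1 : 1 < q) (cF : contdiff F) (pF : positive_definite F).
Local Notation mu := (@lebesgue_measure R).
Local Notation D := (`[0%R, +oo[%classic : set R).
Implicit Types (x y : R -> 'cV[R]_n.+1) (u v : R -> R).

Definition running u x (t : R) : R := `|u t| `^ q / q + F (x t).

Let q0 : 0 < q. Proof. exact: lt_trans q1. Qed.

Lemma running_ge0 u x t : 0 <= running u x t.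
Proof.
by rewrite addr_ge0 ?positive_definite_ge0// divr_ge0 ?powR_ge0// ltW.
Qed.

Lemma measurable_powR_norm u : measurable_fun D u ->
  measurable_fun D (fun t => `|u t| `^ q / q).
Proof.
move=> mu_; apply: measurable_funM; last exact: measurable_cst.
apply: (measurableT_comp (measurable_powR _)).
by apply: measurableT_comp.
Qed.

Lemma continuous_comp_max0 (G : 'cV[R]_n.+1 -> R) x : continuous G ->
  continuous (fun t : R => x (Num.max 0 t)) -> continuous (fun t : R => G (x (Num.max 0 t))).
Proof. by move=> cG cx t; apply: continuous_comp; [exact: cx|exact: cG]. Qed.

Lemma running_measurable (x0 : 'cV[R]_n.+1) u x : admissible q u -> trajectory x0 u x ->
  measurable_fun D (running u x).
Proof.
move=> /admissible_measurable mu_ /trajectory_continuous cx.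
apply: measurable_funD; first exact: measurable_powR_norm.
by apply: measurable_max0; apply: (@continuous_comp_max0 F x) => //; exact: contdiff_continuous.
Qed.

Lemma running_integrable (x0 : 'cV[R]_n.+1) u x : admissible q u -> trajectory x0 u x ->
  (cost q F u x < +oo)%E -> mu.-integrable D (EFin \o running u x).
Proof.
move=> hu hx cfin; apply/integrableP; split.
  by apply/measurable_EFinP; exact: running_measurable hu hx.
apply: le_lt_trans cfin; rewrite le_eqVlt; apply/orP; left; apply/eqP.
by apply: eq_integral => t _; rewrite /= ger0_norm// running_ge0.
Qed.

Lemma state_cost_integrable (x0 : 'cV[R]_n.+1) u x : admissible q u -> trajectory x0 u x ->
  (cost q F u x < +oo)%E -> mu.-integrable D (EFin \o (F \o x)).
Proof.
move=> hu hx cfin; apply: integrable_dominated (running_integrable hu hx cfin) _ => //.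
  apply: measurable_max0; apply: (@continuous_comp_max0 F x); first exact: contdiff_continuous.
  exact: trajectory_continuous hx.
move=> t _; rewrite ger0_norm ?positive_definite_ge0// lerDr.
by rewrite divr_ge0 ?powR_ge0// ltW.
Qed.

Lemma continuous_max0_bounded x (T : R) : continuous (fun t : R => x (Num.max 0 t)) ->
  exists M : R, forall t : R, 0 <= t <= T -> `|x t| <= M.
Proof.
move=> cx; have [T0|T0] := leP 0 T; last first.
  by exists 0 => t /andP[t0 tT]; have := le_lt_trans (le_trans t0 tT) T0; rewrite ltxx.
have [] := @EVT_max R (fun t => `|x (Num.max 0 t)|) 0 T T0.
  by apply: continuous_subspaceT => t; apply: cvg_norm; exact: cx.
move=> c _ hc; exists (`|x (Num.max 0 c)|) => t tT; have := hc t.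
by rewrite in_itv/= => /(_ tT); rewrite max_r//; case/andP: tT.
Qed.

(** The control term is integrable because [L^q] is a vector space. The state term is compared with
    [F (x t)], integrable by finiteness of the cost: the difference is bounded on the support of [y]
    and zero beyond it. *)
Lemma perturbed_integrable (x0 : 'cV[R]_n.+1) u x v y (a : R) : admissible q u -> trajectory x0 u x ->
  (cost q F u x < +oo)%E -> is_test v y ->
  mu.-integrable D (EFin \o running (fun t => a * v t + u t) (fun t => a *: y t + x t)).
Proof.
move=> hu hx cfin hy.
have hv := is_test_admissible q1 hy.
have cx := trajectory_continuous hx.
have cF' := contdiff_continuous cF.
have I1 := admissible_integrable q1 (admissible_lin a q1 hu hv).
have I2 := state_cost_integrable hu hx cfin.
have I3 : mu.-integrable D (EFin \o (fun t => F (a *: y t + x t) - F (x t))).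
  have [_ [M hM] [T hT] _ _] := hy.
  have [X hX] := continuous_max0_bounded T cx.
  have [B hB] := continuous_bounded_ball (`|a| * M + X) cF'.
  have [B' hB'] := continuous_bounded_ball X cF'.
  apply: (@integrable_bounded _ _ (`|B| + `|B'|) T).
  - apply: measurable_funB; apply: measurable_max0; last exact: (@continuous_comp_max0 F x).
    apply: (@continuous_comp_max0 F (fun t => a *: y t + x t)) => //.
    exact: trajectory_continuous (trajectory_lin a hx hy).
  - move=> t t0; have [tT|/hT[_ ->]] := leP t T; last first.
      by rewrite scaler0 add0r subrr normr0 addr_ge0.
    have Xt : `|x t| <= X by apply: hX; rewrite t0.
    apply: le_trans (ler_normB _ _) _; apply: lerD.
      apply: le_trans (ler_norm B); apply: hB; apply: le_trans (ler_normD _ _) _.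
      by rewrite lerD// normrZ ler_wpM2l//; have [] := hM t t0.
    by apply: le_trans (ler_norm B'); exact: hB'.
  - by move=> t /hT[_ ->]; rewrite scaler0 add0r subrr.
have := integrable_lin q^-1 (measurable_itv _) I1 (integrable_lin 1 (measurable_itv _) I3 I2).
rewrite (_ : (fun t => _) = running (fun t => a * v t + u t) (fun t => a *: y t + x t))//.
by apply/funext => t; rewrite /running mul1r subrK [q^-1 * _]mulrC.
Qed.

End cost_integrability.

Section first_variation.
Context {R : realType} {n : nat} (q : R) (F : 'cV[R]_n.+1 -> R).
Context (q1 : 1 < q) (cF : contdiff F) (vF : is_convex F) (pF : positive_definite F).
Local Notation mu := (@lebesgue_measure R).
Local Notation D := (`[0%R, +oo[%classic : set R).
Implicit Types (x y : R -> 'cV[R]_n.+1) (u v : R -> R).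

Let q0 : 0 < q. Proof. exact: lt_trans q1. Qed.

Lemma norm_powR_slope_cvg (a b : R) :
  h^-1 * (`|h * b + a| `^ q / q - `|a| `^ q / q) @[h --> 0^'] --> spow a (q - 1) * b.
Proof.
have d1 : is_derive (0 : R) 1 (fun h : R => h * b + a) b.
  have := is_deriveD (is_deriveM (is_derive_id (0 : R) 1) (is_derive_cst b (0 : R) 1)) (is_derive_cst a (0 : R) 1).
  rewrite scaler0 add0r addr0 [_%:A]mulr1.
  by [].
have d2 : is_derive (0 * b + a) 1 (fun c : R => `|c| `^ q / q) (spow a (q - 1)).
  by rewrite mul0r add0r; exact: is_derive_norm_powR.
have /is_derive_cvg := @is_derive1_comp _ (fun c : R => `|c| `^ q / q) (fun h => h * b + a) 0 _ _ d2 d1.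
apply: cvg_trans; apply: near_eq_cvg; apply: nearW => h.
by rewrite /= mul0r add0r addr0 [h *: 1]mulr1.
Qed.

Lemma convex_norm_powR : is_convex (fun a : R^o => `|a| `^ q / q).
Proof.
move=> a b t /andP[t0 t1]; rewrite !mulrA -mulrDl ler_pM2r ?invr_gt0//.
have := @convex_powR R q (ltW q1) (Itv01 t0 t1) `|a| `|b|.
rewrite !inE/= !in_itv/= !andbT => /(_ (normr_ge0 _) (normr_ge0 _)).
rewrite !convRE/=; apply: le_trans; rewrite ge0_ler_powR ?nnegrE ?(ltW q0)//.
  by rewrite addr_ge0// mulr_ge0// subr_ge0.
rewrite (le_trans (ler_normD _ _))// !normrM (ger0_norm t0).
by rewrite (ger0_norm (x := 1 - t))// subr_ge0.
Qed.

(** The directional derivative of the running cost at [(u, x)] along [(v, y)]. *)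
Definition pairing u x v y (t : R) : R :=
  spow (u t) (q - 1) * v t + \sum_i gradient F (x t) i 0 * y t i 0.

Lemma running_slope_cvg u x v y t : h^-1 * (running q F (fun t => h * v t + u t)
    (fun t => h *: y t + x t) t - running q F u x t) @[h --> 0^'] --> pairing u x v y t.
Proof.
apply: (@cvg_trans _ ((fun h : R => h^-1 * (`|h * v t + u t| `^ q / q - `|u t| `^ q / q) +
    h^-1 * (F (x t + h *: y t) - F (x t))) @ (0 : R)^')).
  apply: near_eq_cvg; apply: nearW => h.
  by rewrite /running /= -mulrDr [x t + _]addrC addrACA opprD.
exact: cvgD (@norm_powR_slope_cvg (u t) (v t)) (@gradient_cvg _ _ _ cF (x t) (y t)).
Qed.

(** The triangle inequality turns the differences in [convex_slope_bound] into running costs of the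
    perturbations with steps 1, -1 and 0, each of which is integrable. *)
Lemma running_slope_bound u x v y t (h : R) : 0 < h <= 1 ->
  `|h^-1 * (running q F (fun t => h * v t + u t) (fun t => h *: y t + x t) t - running q F u x t)| <=
  running q F (fun t => 1 * v t + u t) (fun t => 1 *: y t + x t) t +
  running q F (fun t => -1 * v t + u t) (fun t => -1 *: y t + x t) t +
  2 * running q F u x t.
Proof.
move=> h01; have H1 := convex_slope_bound (u t : R^o) (v t : R^o) convex_norm_powR h01.
have H2 := convex_slope_bound (x t) (y t) vF h01.
rewrite /running /= opprD addrACA mulrDr.
rewrite [h * _ + _]addrC [h *: _ + _]addrC !mul1r !scale1r !mulN1r !scaleN1r.
rewrite [v t + _]addrC [- v t + _]addrC [y t + _]addrC [- y t + _]addrC.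
have n1 (c : R) : 0 <= `|c| `^ q / q by rewrite divr_ge0 ?powR_ge0// ltW.
have n2 := positive_definite_ge0 pF.
apply: le_trans (ler_normD _ _) _.
apply: le_trans (lerD H1 H2) _.
have B1 := ler_normB (`|u t + v t| `^ q / q) (`|u t| `^ q / q).
have B2 := ler_normB (`|u t| `^ q / q) (`|u t - v t| `^ q / q).
have B3 := ler_normB (F (x t + y t)) (F (x t)).
have B4 := ler_normB (F (x t)) (F (x t - y t)).
rewrite !(ger0_norm (n1 _)) in B1 B2; rewrite !(ger0_norm (n2 _)) in B3 B4.
lra.
Qed.

(** Dominated convergence along the steps [1 / (k + 1)]. Integrability is stated apart from the sign
    because steering pairs with nonzero initial state are paired too, and these do not compete with
    [(u, x)]. *)
Lemma first_variation (x0 : 'cV[R]_n.+1) u x v y : admissible q u -> trajectory x0 u x ->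
  (cost q F u x < +oo)%E -> is_test v y ->
  mu.-integrable D (EFin \o pairing u x v y) /\
  ((forall a : R, 0 < a -> (cost q F u x <= cost q F (fun t => (a * v t + u t)%R)
     (fun t => (a *: y t + x t)%R))%E) -> 0 <= \int[mu]_(t in D) pairing u x v y t).
Proof.
move=> hu hx cfin hy.
have I a := perturbed_integrable q1 cF pF a hu hx cfin hy.
have I0 := running_integrable q1 cF pF hu hx cfin.
pose f k t : R := k.+1%:R * (running q F (fun t => k.+1%:R^-1 * v t + u t)
    (fun t => k.+1%:R^-1 *: y t + x t) t - running q F u x t).
have fI k : mu.-integrable D (EFin \o f k).
  have := integrable_lin k.+1%:R (measurable_itv _) (I k.+1%:R^-1)
    (integrable_lin (- k.+1%:R - 1) (measurable_itv _) I0 I0).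
  rewrite (_ : (fun t => _) = f k)//; apply/funext => t; rewrite /f.
  by ring.
have fcvg t : f k t @[k --> \oo] --> pairing u x v y t.
  have c0 : k.+1%:R^-1 @[k --> \oo] --> (0 : R)^'.
    move=> P hP; have H : \forall k \near \oo, k.+1%:R^-1 != 0 :> R -> P k.+1%:R^-1.
      exact: (@cvg_harmonic R _ hP).
    suff : \forall k \near \oo, P k.+1%:R^-1 by [].
    by apply: filterS H => k; apply; rewrite invr_neq0// pnatr_eq0.
  have := cvg_comp _ _ c0 (@running_slope_cvg u x v y t).
  apply: cvg_trans; apply: near_eq_cvg; apply: nearW => k.
  by rewrite /f /= invrK.
pose g t : R := running q F (fun t => 1 * v t + u t) (fun t => 1 *: y t + x t) t +
  running q F (fun t => -1 * v t + u t) (fun t => -1 *: y t + x t) t +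
  2 * running q F u x t.
have gI : mu.-integrable D (EFin \o g).
  have := integrable_lin 1 (measurable_itv _) (I 1) (integrable_lin 1 (measurable_itv _) (I (-1))
    (integrable_lin 1 (measurable_itv _) I0 I0)).
  rewrite (_ : (fun t => _) = g)//; apply/funext => t; rewrite /g.
  by ring.
have [pI _ pcvg] : [/\ mu.-integrable D (EFin \o pairing u x v y),
    (\int[mu]_(t in D) `|(f k t)%:E - (pairing u x v y t)%:E| @[k --> \oo] --> 0)%E &
    (\int[mu]_(t in D) (f k t)%:E @[k --> \oo] --> \int[mu]_(t in D) (pairing u x v y t)%:E)%E].
  apply: (@dominated_convergence _ _ _ mu D _ (fun k => EFin \o f k) (EFin \o pairing u x v y) (EFin \o g)) => //.
  - by move=> k; have /integrableP[] := fI k.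
  - apply: (@emeasurable_fun_cvg _ _ _ _ (fun k => EFin \o f k)).
      by move=> k; have /integrableP[] := fI k.
    by move=> t _; apply: cvg_EFin; [exact: nearW|exact: fcvg].
  - by apply: aeW => t _; apply: cvg_EFin; [exact: nearW|exact: fcvg].
  - apply: aeW => t k _; rewrite lee_fin.
    have := @running_slope_bound u x v y t k.+1%:R^-1; rewrite invrK; apply.
    by rewrite invr_gt0 ltr0Sn/= invf_le1 ?ltr0Sn// ler1n.
split => // opt.
rewrite -lee_fin /Rintegral fineK; last exact: integrable_fin_num.
apply: cvge_ge pcvg; apply: nearW => k.
rewrite -(fineK (integrable_fin_num _ (fI k)))// lee_fin -[fine _]/(\int[mu]_(t in D) f k t).
have costE w z : mu.-integrable D (EFin \o running q F w z) ->
    cost q F w z = (\int[mu]_(t in D) running q F w z t)%:E.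
  by move=> wz; rewrite /Rintegral fineK//; exact: integrable_fin_num.
have k0 : 0 < k.+1%:R :> R by rewrite ltr0Sn.
have := opt k.+1%:R^-1; rewrite invr_gt0 => /(_ k0).
rewrite !costE// lee_fin => le_cost.
rewrite RintegralZl//; last first.
  have := integrable_lin (-1) (measurable_itv _) I0 (I k.+1%:R^-1).
  rewrite (_ : (fun t => _) = (fun t => running q F (fun t => k.+1%:R^-1 * v t + u t)
    (fun t => k.+1%:R^-1 *: y t + x t) t - running q F u x t))//.
  by apply/funext => t; ring.
by rewrite RintegralB// mulr_ge0 ?(ltW k0)// subr_ge0.
Unshelve. all: by end_near. Qed.

End first_variation.

(** * Steering costs and the vanishing of the first variation *)

Section optimality.
Context {R : realType} {n : nat} (q : R) (F : 'cV[R]_n.+1 -> R).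
Context (q1 : 1 < q) (cF : contdiff F) (vF : is_convex F) (pF : positive_definite F).
Local Notation mu := (@lebesgue_measure R).
Local Notation D := (`[0%R, +oo[%classic : set R).
Implicit Types (x y : R -> 'cV[R]_n.+1) (u v : R -> R).

Let q0 : 0 < q. Proof. exact: lt_trans q1. Qed.

(** The combination of steering pairs is bounded by [K * |x0|] and vanishes after time 1, so its
    cost is at most its largest possible running cost. The bound [M] on [F] is left open to serve
    both on large balls, for finiteness, and near 0, for smallness. *)
Lemma steering_cost : exists2 K : R, 0 <= K & forall x0 : 'cV[R]_n.+1, exists v y,
  [/\ is_test v y, y 0 = x0 & forall M : R, (forall z, `|z| <= K * `|x0| -> F z <= M) ->
    (cost q F v y <= ((K * `|x0|) `^ q / q + M)%:E)%E].
Proof.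
have [phi hphi] := @steering_polys R n.
have tj j := test_pair (@ler01 R) (hphi j).1.
have /fin_all_exists[M hM] : forall j : 'I_n.+1, exists M : R, forall t, 0 <= t ->
  `|test_control n (phi j) 1 t| <= M /\ `|test_state n (phi j) 1 t| <= M.
  by move=> j; have [_ [M hM] _ _ _] := tj j; exists M.
have M0 j : 0 <= M j by have [/(le_trans (normr_ge0 _))] := hM j 0 (lexx 0).
exists (\sum_j M j); first exact: sumr_ge0.
move=> x0; exists (fun t => \sum_j x0 j 0 * test_control n (phi j) 1 t),
  (fun t => \sum_j x0 j 0 *: test_state n (phi j) 1 t).
have sumM (c : 'I_n.+1 -> R) : (forall j, c j <= `|x0| * M j) -> \sum_j c j <= (\sum_j M j) * `|x0|.
  by move=> hc; rewrite mulrC mulr_sumr; apply: ler_sum => j _; exact: hc.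
have vM t : 0 <= t -> `|\sum_j x0 j 0 * test_control n (phi j) 1 t| <= (\sum_j M j) * `|x0|.
  move=> t0; apply: le_trans (ler_norm_sum _ _ _) _; apply: sumM => j.
  by rewrite normrM ler_pM ?normr_coord//; have [] := hM j t t0.
have yM t : 0 <= t -> `|\sum_j x0 j 0 *: test_state n (phi j) 1 t| <= (\sum_j M j) * `|x0|.
  move=> t0; apply: le_trans (ler_norm_sum _ _ _) _; apply: sumM => j.
  by rewrite normrZ ler_pM ?normr_coord//; have [] := hM j t t0.
split; first exact: is_test_sum.
  exact: steering_initial (fun j => (hphi j).2).
move=> B hB; set v := (fun t => _); set y := (fun t => _); set c := _ `^ q / q + B.
have B0 : 0 <= B.
  by rewrite -pF.1; apply: hB; rewrite normr0 mulr_ge0// sumr_ge0.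
have c0 : 0 <= c by rewrite addr_ge0// divr_ge0 ?powR_ge0// ltW.
have z1 t : 1 < t -> v t = 0 /\ y t = 0.
  move=> t1; split; apply: big1 => j _.
    by rewrite /test_control leNgt t1 mulr0.
  apply/colP => i; rewrite !mxE min_r ?(ltW t1)// (root_derivn (hphi j).1)//.
  by rewrite mulr0.
have hy : is_test v y by exact: is_test_sum.
have mr := running_measurable cF (is_test_admissible q1 hy) (is_test_trajectory hy).
apply: (@le_trans _ _ (\int[mu]_(t in D) (((fun=> c) \_ `[0%R, 1%R]) t)%:E)%E).
  apply: ge0_le_integral => //.
  - by move=> t _; rewrite lee_fin; exact: running_ge0.
  - by apply/measurable_EFinP.
  - apply/measurable_EFinP; apply: measurable_funTS.
    by apply/(measurable_restrictT _ _).1 => //; exact: measurable_cst.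
  - move=> t /=; rewrite in_itv/= andbT => t0; rewrite lee_fin patchE; case: ifPn => [_|].
      apply: lerD; last by apply: hB; exact: yM.
      rewrite ler_pM2r ?invr_gt0// ge0_ler_powR ?nnegrE ?(ltW q0)//; last exact: vM.
      by rewrite mulr_ge0// sumr_ge0.
    rewrite notin_setE/= in_itv/= t0/= => /negP; rewrite -ltNge => /z1[-> ->].
    by rewrite normr0 powR0 ?gt_eqF// mul0r add0r pF.1.
have -> : (\int[mu]_(t in D) (((fun=> c) \_ `[0%R, 1%R]) t)%:E = \int[mu]_(t in `[0%R, 1%R]) c%:E)%E.
  rewrite [RHS]integral_mkcond [LHS]integral_mkcond; apply: eq_integral => t _.
  rewrite !patchE; case: ifPn => tD; first by case: ifP.
  case: ifPn => //; rewrite inE/= => /andP[t0 _].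
  by case/negP: tD; rewrite inE/= in_itv/= andbT; move: t0; rewrite bnd_simp.
rewrite integral_cst//= lebesgue_measure_itv/= lte_fin ltr01 -EFinD -EFinM subr0 mulr1.
by [].
Qed.

Lemma optimal_cost_le (x0 : 'cV[R]_n.+1) v y u x M : is_test v y -> y 0 = x0 ->
  (cost q F v y <= M)%E -> optimal q F x0 u x -> (cost q F u x <= M)%E.
Proof.
move=> hy y0 cM [_ _ opt]; apply: le_trans cM; apply: opt.
  exact: is_test_admissible hy.
by rewrite -y0; exact: is_test_trajectory.
Qed.

Lemma optimal_cost_lty (x0 : 'cV[R]_n.+1) u x : optimal q F x0 u x -> (cost q F u x < +oo)%E.
Proof.
have [K K0 hK] := steering_cost; have [v [y [hy y0 hM]]] := hK x0.
have [M hM'] := continuous_bounded_ball (K * `|x0|) (contdiff_continuous cF).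
move=> opt; apply: le_lt_trans (ltry ((K * `|x0|) `^ q / q + M)).
apply: optimal_cost_le hy y0 _ opt; apply: hM => z zK.
by apply: le_trans (ler_norm _) _; exact: hM'.
Qed.

Lemma pairing_lin u x v y v' y' (a t : R) :
  pairing q F u x (fun t => a * v t + v' t) (fun t => a *: y t + y' t) t =
  a * pairing q F u x v y t + pairing q F u x v' y' t.
Proof.
rewrite /pairing; under eq_bigr do rewrite [(a *: y t + y' t) _ _]mxE [(a *: y t) _ _]mxE mulrDr mulrCA.
by rewrite big_split/= -mulr_sumr; ring.
Qed.

Lemma pairing_integrable (x0 : 'cV[R]_n.+1) u x v y : optimal q F x0 u x -> is_test v y ->
  mu.-integrable D (EFin \o pairing q F u x v y).
Proof.
move=> opt hy; have [hu hx _] := opt.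
by have [] := first_variation q1 cF vF pF hu hx (optimal_cost_lty opt) hy.
Qed.

Lemma pairing_integral_lin (x0 : 'cV[R]_n.+1) u x v y v' y' (a : R) : optimal q F x0 u x ->
  is_test v y -> is_test v' y' ->
  \int[mu]_(t in D) pairing q F u x (fun t => a * v t + v' t) (fun t => a *: y t + y' t) t =
  a * (\int[mu]_(t in D) pairing q F u x v y t) + \int[mu]_(t in D) pairing q F u x v' y' t.
Proof.
move=> opt hy hy'; have I := pairing_integrable opt hy; have I' := pairing_integrable opt hy'.
under eq_Rintegral do rewrite pairing_lin.
by rewrite Rintegral_lin.
Qed.

Lemma optimal_pairing_ge0 (x0 : 'cV[R]_n.+1) u x v y : optimal q F x0 u x ->
  is_test v y -> y 0 = 0 -> 0 <= \int[mu]_(t in D) pairing q F u x v y t.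
Proof.
move=> opt hy y0; have [hu hx omin] := opt.
have [_ ->//] := first_variation q1 cF vF pF hu hx (optimal_cost_lty opt) hy.
move=> a a0; apply: omin.
  by apply: admissible_lin => //; exact: is_test_admissible hy.
by have := trajectory_lin a hx hy; rewrite y0 scaler0 add0r.
Qed.

(** The opposite pair is a test as well, so the inequality holds in both directions. The zero pair
    only serves to write the opposite pair as a linear combination. *)
Lemma optimal_pairing0 (x0 : 'cV[R]_n.+1) u x v y : optimal q F x0 u x ->
  is_test v y -> y 0 = 0 -> \int[mu]_(t in D) pairing q F u x v y t = 0.
Proof.
move=> opt hy y0; apply/eqP; rewrite eq_le (optimal_pairing_ge0 opt hy y0) andbT.
have hy0 := @is_test0 R n.
have L0 : \int[mu]_(t in D) pairing q F u x (fun=> 0) (fun=> 0) t = 0.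
  have -> : pairing q F u x (fun=> 0) (fun=> 0) = fun=> 0.
    by apply/funext => t; rewrite /pairing mulr0 add0r big1// => i _; rewrite [X in _ * X]mxE mulr0.
  by rewrite Rintegral_cst// mul0r.
have := optimal_pairing_ge0 opt (is_test_lin (-1) hy hy0).
rewrite y0 scaler0 addr0 => /(_ erefl); rewrite (pairing_integral_lin _ opt)// L0; lra.
Qed.

Lemma pairing_integral_sum (x0 : 'cV[R]_n.+1) u x (I : Type) (r : seq I) (c : I -> R)
    (v : I -> R -> R) (y : I -> R -> 'cV[R]_n.+1) : optimal q F x0 u x ->
  (forall i, is_test (v i) (y i)) ->
  \int[mu]_(t in D) pairing q F u x (fun t => \sum_(i <- r) c i * v i t)
      (fun t => \sum_(i <- r) c i *: y i t) t =
  \sum_(i <- r) c i * \int[mu]_(t in D) pairing q F u x (v i) (y i) t.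
Proof.
move=> opt hy; elim: r => [|i r IH].
  have -> : (fun t => \sum_(i <- [::]) c i * v i t) = fun=> 0.
    by apply/funext => t; rewrite big_nil.
  have -> : (fun t => \sum_(i <- [::]) c i *: y i t) = fun=> 0.
    by apply/funext => t; rewrite big_nil.
  by rewrite big_nil; exact: (optimal_pairing0 opt (@is_test0 R n)).
have -> : (fun t => \sum_(j <- i :: r) c j * v j t) =
    fun t => c i * v i t + \sum_(j <- r) c j * v j t.
  by apply/funext => t; rewrite big_cons.
have -> : (fun t => \sum_(j <- i :: r) c j *: y j t) =
    fun t => c i *: y i t + \sum_(j <- r) c j *: y j t.
  by apply/funext => t; rewrite big_cons.
by rewrite big_cons -IH -(pairing_integral_lin _ opt)//; exact: is_test_sum.
Qed.

End optimality.

(** * Adjoint equation and extremal lifts *)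

Section adjoint.
Context {R : realType} {n : nat}.
Local Notation mu := (@lebesgue_measure R).
Local Notation D := (`[0%R, +oo[%classic : set R).
Implicit Types (p g : R -> 'cV[R]_n.+1).

(** The matrix of the adjoint equation is strictly lower triangular, so the coordinates are found
    one after the other by integration. Indices are natural numbers to allow structural
    recursion. *)
Fixpoint adjoint_coord (g : nat -> R -> R) (c : nat -> R) (i : nat) : R -> R :=
  fun t => c i + prim (if i is j.+1 then fun s => g i s - adjoint_coord g c j s else g i) t.

Lemma adjoint_coord_continuous (g : nat -> R -> R) (c : nat -> R) i :
  (forall j, continuous (g j)) -> continuous (adjoint_coord g c i).
Proof.
move=> cg; elim: i => [|i IH] t; apply: cvgD; (try exact: cvg_cst); apply: prim_continuous => //.
by move=> s; apply: cvgB; [exact: cg|exact: IH].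
Qed.

Lemma adjoint_coord_derive (g : nat -> R -> R) (c : nat -> R) (i : nat) (t : R) :
  (forall j, continuous (g j)) -> 0 < t -> is_derive t 1 (adjoint_coord g c i)
    (if i is j.+1 then g i t - adjoint_coord g c j t else g i t).
Proof.
move=> cg t0; have ci j : continuous (adjoint_coord g c j) by exact: adjoint_coord_continuous.
have H (h : R -> R) : continuous h -> is_derive t 1 (fun s => c i + prim h s) (h t).
  move=> ch; rewrite -[X in is_derive _ _ _ X]add0r.
  by apply: is_deriveD; exact: prim_derive.
case: i H => [|i] H; apply: H => // s; apply: cvgB; [exact: cg|exact: ci].
Qed.

Lemma adjoint_exists g (c : 'cV[R]_n.+1) : continuous g -> exists p,
  [/\ continuous p, p 0 = c &
      forall t : R, 0 < t -> is_derive t 1 p (- ((jordan n)^T *m p t) + g t)].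
Proof.
move=> cg; pose G i t := g t (inord i) 0; pose C i := c (inord i) 0.
have cG i : continuous (G i).
  by move=> t; have /(cvg_coordP (nbhs_filter t)) := cg t; apply.
exists (fun t => \col_i adjoint_coord G C i t); split.
- move=> t; apply/(cvg_coordP (nbhs_filter t)) => i; rewrite mxE.
  by under eq_fun do rewrite mxE; exact: adjoint_coord_continuous.
- apply/colP => i; rewrite mxE /C; case: i => -[|i] hi /=; rewrite prim_le0 ?addr0//;
    by congr (c _ 0); apply/val_inj; rewrite /= inordK.
- move=> t t0; apply: is_derive_col => i; under eq_fun do rewrite mxE.
  have -> : (- ((jordan n)^T *m (\col_i0 adjoint_coord G C i0 t)) + g t) i 0 =
    (if val i is j.+1 then G i t - adjoint_coord G C j t else G i t).
    rewrite mxE [X in X + _]mxE trjordanE mxE /G; case: i => -[|i] hi /=.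
      by rewrite oppr0 add0r; congr (g t _ 0); apply/val_inj; rewrite /= inordK.
    rewrite inordK ?(ltn_trans _ hi)// addrC; congr (g t _ 0 - _).
    by apply/val_inj; rewrite /= inordK.
  exact: (@adjoint_coord_derive G C i t cG t0).
Qed.

Lemma C1_abs_continuous p g (T : R) : continuous p -> continuous g ->
  (forall t : R, 0 < t -> is_derive t 1 p (g t)) -> 0 <= T -> abs_continuous 0 T p.
Proof.
move=> cp cg dp T0.
have /fin_all_exists[K hK] : forall i : 'I_n.+1, exists K : R, 0 <= K /\
    forall s t, 0 <= s -> s <= t -> t <= T -> `|p t i 0 - p s i 0| <= K * (t - s).
  move=> i; have [|||K K0 hK] := @C1_lipschitz _ (fun t => p t i 0) (fun t => g t i 0) T _ _ _ T0.
  - by move=> t; have /(cvg_coordP (nbhs_filter t)) := cp t; apply.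
  - by move=> t; have /(cvg_coordP (nbhs_filter t)) := cg t; apply.
  - by move=> t t0; apply: is_derive_coord; exact: dp.
  - by exists K.
apply: (@lipschitz_abs_continuous _ _ _ _ (\sum_i K i)) => s t s0 st tT.
apply: normr_le_coord => i; rewrite !mxE; apply: le_trans ((hK i).2 _ _ s0 st tT) _.
rewrite ler_wpM2r ?subr_ge0// (bigD1 i)//= lerDl sumr_ge0// => j _.
by have [] := hK j.
Qed.

(** Duality of the adjoint and state equations: the shifted coordinates of [p] telescope against the
    successive derivatives of [phi], and only the term in the last coordinate survives. The shift
    [t0] is 0 in the pairing formula and the start of the window in the bound on [p]. *)
Lemma adjoint_poly_derive p (gs : 'cV[R]_n.+1) (phi : {poly R}) (t0 s : R) :
  is_derive s 1 p (- ((jordan n)^T *m p s) + gs) ->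
  is_derive s 1 (fun r => \sum_i p r i 0 * phi^`(i).[r - t0])
    (p s ord_max 0 * phi^`(n.+1).[s - t0] + \sum_i gs i 0 * phi^`(i).[s - t0]).
Proof.
move=> dp.
have dphi (i : nat) : is_derive s 1 (fun r : R => phi^`(i).[r - t0]) (phi^`(i.+1).[s - t0]).
  have d1 : is_derive s 1 (fun r : R => r - t0) 1.
    have := is_deriveB (is_derive_id s (1 : R)) (is_derive_cst t0 s 1).
    by rewrite subr0.
  have := @is_derive1_comp _ (horner phi^`(i)) (fun r : R => r - t0) s _ _ (is_derive_horner _ _) d1.
  by rewrite mulr1 derivnS.
have := @is_derive_sum _ _ _ n.+1 (fun (i : 'I_n.+1) r => p r i 0 * phi^`(i).[r - t0]) s 1
  (fun i : 'I_n.+1 => p s i 0 *: phi^`(i.+1).[s - t0] +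
     phi^`(i).[s - t0] *: (- ((jordan n)^T *m p s) + gs) i 0)
  (fun i => is_deriveM (is_derive_coord i dp) (dphi i)).
rewrite [X in is_derive _ _ X _ -> _](_ : _ = fun r => \sum_i p r i 0 * phi^`(i).[r - t0]); last first.
  by apply/funext => r; rewrite fct_sumE.
suff -> : \sum_(i < n.+1) (p s i 0 *: phi^`(i.+1).[s - t0] +
     phi^`(i).[s - t0] *: (- ((jordan n)^T *m p s) + gs) i 0) =
  p s ord_max 0 * phi^`(n.+1).[s - t0] + \sum_i gs i 0 * phi^`(i).[s - t0] by [].
rewrite big_split/=.
have -> : \sum_(i < n.+1) phi^`(i).[s - t0] *: (- ((jordan n)^T *m p s) + gs) i 0 =
  \sum_i gs i 0 * phi^`(i).[s - t0] - \sum_(i < n.+1) ((jordan n)^T *m p s) i 0 * phi^`(i).[s - t0].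
  rewrite -sumrB; apply: eq_bigr => i _; move: (_ *m _) => w; rewrite !mxE.
  by rewrite /GRing.scale/=; ring.
rewrite addrCA addrC; congr (_ + _).
(* Removing the last term of one sum and the first, zero, term of the other makes the two sums match
   index by index. *)
rewrite big_ord_recr/= [X in _ - X]big_ord_recl/= trjordanE mul0r add0r.
rewrite addrAC -sumrB big1 ?add0r// => i _.
rewrite trjordanE /= [_ *: _]mulrC mulrC; apply/eqP; rewrite subr_eq0; apply/eqP.
rewrite add0n; congr (p s _ 0 * _); apply/val_inj.
by rewrite /= inordK// (ltn_trans (ltn_ord i)).
Qed.

(** Integration by parts over [[0, b]]: the boundary term at [b] vanishes with the derivatives of
    [phi], leaving the one at 0. *)
Lemma adjoint_pairing p g (phi : {poly R}) (b : R) : continuous p -> continuous g ->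
  (forall t : R, 0 < t -> is_derive t 1 p (- ((jordan n)^T *m p t) + g t)) ->
  0 <= b -> ('X - b%:P) ^+ n.+1 %| phi ->
  let k t := p t ord_max 0 * test_control n phi b t + \sum_i g t i 0 * test_state n phi b t i 0 in
  mu.-integrable D (EFin \o k) /\
  \int[mu]_(t in D) k t = - \sum_i p 0 i 0 * phi^`(i).[0].
Proof.
move=> cp cg dp b0 hphi k.
pose k' (t : R) := p t ord_max 0 * phi^`(n.+1).[t] + \sum_i g t i 0 * phi^`(i).[t].
have cpc i : continuous (fun t => p t i 0).
  by move=> t; have /(cvg_coordP (nbhs_filter t)) := cp t; apply.
have cgc i : continuous (fun t => g t i 0).
  by move=> t; have /(cvg_coordP (nbhs_filter t)) := cg t; apply.
have ck' : continuous k'.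
  move=> t; apply: cvgD; first by apply: cvgM; [exact: cpc|exact: continuous_horner].
  apply: cvg_big => //; first by exact: add_continuous.
  by move=> i _; apply: cvgM; [exact: cgc|exact: continuous_horner].
have kE : {in D, k =1 k' \_ `[0%R, b]}.
  move=> t; rewrite inE/= in_itv/= andbT => t0; rewrite patchE /k /k' /test_control.
  have -> : (t \in `[0%R, b]%classic) = (t <= b) by rewrite mem_setE in_itv/= t0.
  case: ifPn => [tb|].
    by congr (_ + _); apply: eq_bigr => i _; rewrite mxE min_l.
  rewrite -ltNge => bt; rewrite mulr0 add0r big1// => i _.
  by rewrite mxE min_r ?(ltW bt)// (root_derivn hphi)// mulr0.
have DE : D `&` `[0%R, b]%classic = `[0%R, b]%classic.
  by apply/setIidr; exact: subset_itvl.
have I : mu.-integrable D (EFin \o (k' \_ `[0%R, b])).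
  rewrite -restrict_EFin; apply/integrable_restrict => //.
  by rewrite DE; exact: continuous_integrable.
split.
  apply: eq_integrable I => // t tD /=.
  by rewrite kE.
have -> : \int[mu]_(t in D) k t = \int[mu]_(t in D) (k' \_ `[0%R, b]) t.
  by apply: eq_Rintegral => t tD; exact: kE.
rewrite -Rintegral_mkcondr DE.
have -> : \int[mu]_(t in `[0%R, b]) k' t = prim k' b by rewrite /prim max_r.
pose f (t : R) := \sum_i p t i 0 * phi^`(i).[t].
have cf : continuous f.
  move=> t; apply: cvg_big => //; first by exact: add_continuous.
  by move=> i _; apply: cvgM; [exact: cpc|exact: continuous_horner].
have : f b + -1 * prim k' b = f 0 + -1 * prim k' 0.
  apply: (@is_derive_eq0_cst _ (fun t => f t + -1 * prim k' t)) => //.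
    move=> t; apply: cvgD; first exact: cf.
    by apply: cvgMr; exact: prim_continuous.
  move=> t /andP[t0 tb].
  suff : is_derive t 1 (fun r => f r + -1 * prim k' r) (k' t + -1 *: k' t) by rewrite scaleN1r subrr.
  apply: is_deriveD; last by apply: is_deriveZ; exact: prim_derive.
  have := adjoint_poly_derive phi 0 (dp t t0).
  rewrite subr0; under [X in is_derive _ _ X _ -> _]eq_fun do rewrite subr0.
  by [].
have -> : f b = 0 by apply: big1 => i _; rewrite (root_derivn hphi)// mulr0.
by rewrite (prim_le0 _ (lexx 0)) /f; lra.
Qed.

End adjoint.

(** * From equalities almost everywhere or between integrals to pointwise ones *)

Section almost_everywhere.
Context {R : realType}.
Local Notation mu := (@lebesgue_measure R).
Local Notation D := (`[0%R, +oo[%classic : set R).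
Implicit Types f g h : R -> R.

(** A point of disagreement would come with a whole interval to its right, of positive measure,
    inside a null set. Using the right side only covers the time 0 as well. *)
Lemma ae_eq_continuous f g : continuous (fun t : R => f (Num.max 0 t)) ->
  continuous (fun t : R => g (Num.max 0 t)) ->
  {ae mu, forall t, 0 < t -> f t = g t} -> forall t, 0 <= t -> f t = g t.
Proof.
move=> cf cg [N [mN N0 hN]] t t0; apply/eqP; rewrite -subr_eq0; apply/negPn/negP => fgt.
have e0 : 0 < `|f t - g t| by rewrite normr_gt0.
have /cvgrPdist_lt/(_ _ e0)[d /= d0 hd] :
    f (Num.max 0 s) - g (Num.max 0 s) @[s --> t] --> f (Num.max 0 t) - g (Num.max 0 t).
  by apply: cvgB; [exact: cf|exact: cg].
have sN : `]t, t + d[%classic `<=` N.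
  move=> s /=; rewrite in_itv/= => /andP[ts std]; apply: hN => /=.
  have s0 : 0 < s by exact: le_lt_trans ts.
  move=> /(_ s0) fgs; have := hd s; rewrite /= (max_r (ltW s0)) (max_r t0) fgs subrr subr0 ltxx.
  suff -> : `|t - s| < d by move=> /(_ isT).
  by rewrite ltr_norml; apply/andP; split; lra.
have : (mu `]t, (t + d)%R[%classic <= 0)%E.
  by rewrite -N0; apply: le_measure; rewrite ?inE//; exact: measurable_itv.
rewrite lebesgue_measure_itv/= lte_fin ltrDl d0 -EFinD lee_fin.
by rewrite addrAC subrr add0r leNgt d0.
Qed.

(** Lebesgue differentiation applied to the extension [k] of [h] by 0: its primitive is identically
    0, and [k] is the derivative of that primitive almost everywhere. *)
Lemma integral_eq0_ae h : measurable_fun D h ->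
  (forall b, 0 < b -> mu.-integrable `[0, b] (EFin \o h)) ->
  (forall b, 0 < b -> \int[mu]_(t in `[0, b]) h t = 0) ->
  {ae mu, forall t, 0 < t -> h t = 0}.
Proof.
move=> mh ih h0; pose k := h \_ D.
have ik (y : R) : mu.-integrable [set` Interval (BLeft 0) (BRight y)] (EFin \o k).
  have [y0|y0] := ltP 0 y.
    apply: eq_integrable (ih _ y0) => // t /=; rewrite inE/= in_itv/= => /andP[t0 _].
    by rewrite /k patchE ifT// inE/= in_itv/= t0.
  apply: (@integrableS _ _ _ mu `[0, 1]) => //; last first.
    apply: eq_integrable (ih _ ltr01) => // t /=; rewrite inE/= in_itv/= => /andP[t0 _].
    by rewrite /k patchE ifT// inE/= in_itv/= t0.
  by apply: subset_itvl; rewrite bnd_simp (le_trans y0).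
have lk : locally_integrable [set: R] k.
  split; first by apply/(measurable_restrictT _ _).1.
    exact: openT.
  move=> K _ cK; have [M [_ hM]] := compact_bounded cK.
  pose T := `|M| + 1.
  have T0 : 0 < T by rewrite ltr_wpDl.
  have KT : K `<=` `[- T, T].
    move=> t Kt; have := hM T _ t Kt; rewrite /T => /(_ _)/wrap[].
      by rewrite ltr_pwDr// ler_norm.
    by rewrite /= ler_norml in_itv.
  have mK : measurable K by apply: closed_measurable; exact: compact_closed.
  have iT : mu.-integrable setT (EFin \o (h \_ `[0, T])).
    by rewrite -restrict_EFin; apply/integrable_restrict => //; rewrite setTI; exact: ih.
  have iK : mu.-integrable K (EFin \o k).
    have iK : mu.-integrable K (EFin \o (h \_ `[0, T])) by exact: integrableS iT.
    apply: eq_integrable iK => // t; rewrite inE => /KT; rewrite /= in_itv/= => /andP[_ tT].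
    by rewrite /k !patchE !mem_setE !in_itv/= andbT tT andbT.
  by have /integrableP[_] := iK.
have := @FTC1 R k (BLeft 0) ik lk.
apply: aeS => t Ht t0; have [] := Ht; first by rewrite /= lte_fin.
rewrite (_ : (fun x => _) = fun=> 0); last first.
  apply/funext => y; have [y0|y0] := ltP 0 y; last first.
    have [->|yn0] := eqVneq y 0; first by rewrite set_itv1 Rintegral_set1.
    by rewrite set_itv_ge ?Rintegral_set0// bnd_simp -ltNge lt_neqAle yn0.
  rewrite -[RHS](h0 _ y0); apply: eq_Rintegral => s; rewrite inE/= in_itv/= => /andP[s0 _].
  by rewrite /k patchE ifT// inE/= in_itv/= s0.
rewrite derive1_cst => _ ->.
by rewrite /k patchE ifT// inE/= in_itv/= ltW.
Qed.

End almost_everywhere.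

(** * The maximum principle: a costate for an optimal pair *)

Section maximum_principle.
Context {R : realType} {n : nat} (q : R) (F : 'cV[R]_n.+1 -> R).
Context (q1 : 1 < q) (cF : contdiff F) (vF : is_convex F) (pF : positive_definite F).
Local Notation mu := (@lebesgue_measure R).
Local Notation D := (`[0%R, +oo[%classic : set R).
Implicit Types (x y p : R -> 'cV[R]_n.+1) (u v : R -> R).

Let q10 : q - 1 != 0. Proof. by rewrite gt_eqF// subr_gt0. Qed.

Lemma derivn_XsubC_exp (b : R) m k :
  (('X - b%:P) ^+ m)^`(k) = ('X - b%:P) ^+ (m - k) *+ m ^_ k.
Proof.
elim: k => [|k IH]; first by rewrite subn0.
rewrite derivnS IH derivMn deriv_exp derivXsubC mul1r -mulrnA mulnC ffactnSr.
by rewrite subnS.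
Qed.

Lemma measurable_spow u r : 0 < r -> measurable_fun D u -> measurable_fun D (fun t => spow (u t) r).
Proof.
move=> r0 mu_; apply: (@measurableT_comp _ _ _ _ _ _ (fun a : R => spow a r)) => //.
by apply: continuous_measurable_fun; exact: continuous_spow.
Qed.

Lemma continuous_gradient_max0 (x0 : 'cV[R]_n.+1) u x : trajectory x0 u x ->
  continuous (fun t : R => gradient F (x (Num.max 0 t))).
Proof.
move=> /trajectory_continuous cx t.
apply: (@continuous_comp _ _ _ (fun t : R => x (Num.max 0 t)) (gradient F)); first exact: cx.
exact: cF.2.
Qed.

Lemma optimal_adjoint (x0 : 'cV[R]_n.+1) u x : optimal q F x0 u x ->
  exists p, [/\ continuous p,
    forall t : R, 0 < t ->
      is_derive t 1 p (- ((jordan n)^T *m p t) + gradient F (x (Num.max 0 t))) &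
    {ae mu, forall t : R, 0 < t -> u t = spow (p t ord_max 0) (q - 1)^-1}].
Proof.
move=> opt; have [hu hx _] := opt.
have cg := continuous_gradient_max0 hx.
have [phi hphi] := @steering_polys R n.
have tj j := test_pair (@ler01 R) (hphi j).1.
pose l j := \int[mu]_(t in D) pairing q F u x (test_control n (phi j) 1) (test_state n (phi j) 1) t.
(* The pairing of p with a test pair of initial state z is - <p 0, z>, so this
   initial value is forced by the steering pairs. *)
have [p [cp p0 dp]] := adjoint_exists (- \col_j l j) cg.
exists p; split => //.
pose h t := spow (u t) (q - 1) - p t ord_max 0.
suff : {ae mu, forall t, 0 < t -> h t = 0}.
  apply: aeS => t ht t0; have := ht t0 => /eqP; rewrite subr_eq0 => /eqP <-.
  by rewrite spowK.
pose psi b : {poly R} := (n.+1`!)%:R^-1 *: ('X - b%:P) ^+ n.+1.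
have hpsi b : ('X - b%:P) ^+ n.+1 %| psi b by rewrite dvdpZr// invr_eq0 pnatr_eq0 -lt0n fact_gt0.
have psin b t : (psi b)^`(n.+1).[t] = 1.
  rewrite derivnZ.
  rewrite derivn_XsubC_exp subnn expr0 ffactnn hornerZ hornerMn hornerC.
  by rewrite mulVf// pnatr_eq0 -lt0n fact_gt0.
have key b : 0 < b -> mu.-integrable `[0, b] (EFin \o h) /\ \int[mu]_(t in `[0, b]) h t = 0.
  move=> b0; have tb := test_pair (ltW b0) (hpsi b).
  pose z0 := test_state n (psi b) b 0.
  pose k t := p t ord_max 0 * test_control n (psi b) b t +
    \sum_i gradient F (x (Num.max 0 t)) i 0 * test_state n (psi b) b t i 0.
  have [kI kint] : mu.-integrable D (EFin \o k) /\
      \int[mu]_(t in D) k t = - \sum_i p 0 i 0 * (psi b)^`(i).[0].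
    exact: (adjoint_pairing cp cg dp (ltW b0) (hpsi b)).
  have tI := pairing_integrable q1 cF vF pF opt tb.
  have tint : \int[mu]_(t in D) pairing q F u x (test_control n (psi b) b)
      (test_state n (psi b) b) t = \sum_j z0 j 0 * l j.
    (* Subtracting a combination of steering pairs cancels the initial state. *)
    have hs := is_test_sum (index_enum _) (fun j => z0 j 0) tj.
    have := optimal_pairing0 q1 cF vF pF opt (is_test_lin (-1) hs tb).
    rewrite (pairing_integral_lin q1 cF vF pF _ opt)// (pairing_integral_sum q1 cF vF pF _ _ opt)//.
    move=> H; have {}H := H _; rewrite mulN1r in H.
    suff E : -1 *: \sum_i z0 i 0 *: test_state n (phi i) 1 0 + z0 = 0.
      by move/eqP: (H E); rewrite addrC subr_eq0 => /eqP.
    by rewrite (steering_initial _ (fun j => (hphi j).2)) scaleN1r addNr.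
  (* Both integrands contain the same gradient terms, which cancel; what is left is [h] times the
     control of the test pair, the indicator of [[0, b]]. *)
  have hE : {in D, (fun t => -1 * k t + pairing q F u x (test_control n (psi b) b)
      (test_state n (psi b) b) t) =1 h \_ `[0, b]}.
    move=> t; rewrite inE/= in_itv/= andbT => t0.
    rewrite /pairing /k max_r//; set S := \sum_i _; rewrite patchE mem_setE in_itv/= t0/=.
    rewrite /test_control psin /h; case: ifP => _; first by ring.
    by rewrite -[RHS]/(0 : R); ring.
  have DE : D `&` `[0%R, b]%classic = `[0%R, b]%classic.
    by apply/setIidr; exact: subset_itvl.
  split.
    rewrite -DE; apply/integrable_restrict => //; rewrite restrict_EFin.
    apply: eq_integrable (integrable_lin (-1) (measurable_itv _) kI tI) => // t tD /=.
    by rewrite hE.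
  rewrite -DE Rintegral_mkcondr.
  have <- : \int[mu]_(t in D) (-1 * k t + pairing q F u x (test_control n (psi b) b)
      (test_state n (psi b) b) t) = \int[mu]_(t in D) (h \_ `[0, b]) t.
    by apply: eq_Rintegral => t tD; exact: hE.
  (* Both integrals equal the sum of the [z0 j 0 * l j], by the choice of [p 0]. *)
  rewrite Rintegral_lin// kint tint p0 mulN1r opprK.
  rewrite -big_split/= big1// => j _; rewrite !mxE min_l ?(ltW b0)//; ring.
apply: integral_eq0_ae.
- apply: measurable_funB; first by apply: measurable_spow; [rewrite subr_gt0|exact: admissible_measurable hu].
  apply: measurable_funTS; apply: continuous_measurable_fun.
  by move=> t; have /(cvg_coordP (nbhs_filter t)) := cp t; apply.
- by move=> b /key[].
- by move=> b /key[].
Qed.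

End maximum_principle.

(** * Regularity, uniqueness and existence of extremal lifts *)

Section extremal_lifts.
Context {R : realType} {n : nat} (q : R) (F : 'cV[R]_n.+1 -> R).
Context (q1 : 1 < q) (cF : contdiff F) (vF : is_convex F) (pF : positive_definite F).
Local Notation mu := (@lebesgue_measure R).
Local Notation D := (`[0%R, +oo[%classic : set R).
Implicit Types (x y p g : R -> 'cV[R]_n.+1) (u v : R -> R).

Let q10 : 0 < q - 1. Proof. by rewrite subr_gt0. Qed.

Lemma continuous_coord g (i : 'I_n.+1) : continuous g -> continuous (fun t => g t i 0).
Proof. by move=> cg t; have /(cvg_coordP (nbhs_filter t)) := cg t; apply. Qed.

(** With a continuous right-hand side each coordinate equals its initial value plus a primitive on
    the half-line, hence is differentiable at every positive time. Derivatives can then be compared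
    pointwise. *)
Lemma ac_derive p g : continuous (fun t : R => g (Num.max 0 t)) ->
  (forall T, 0 <= T -> abs_continuous 0 T p) ->
  {ae mu, forall t : R, 0 < t -> is_derive t 1 p (g t)} ->
  forall t : R, 0 < t -> is_derive t 1 p (g t).
Proof.
move=> cg pac dp t t0; apply: is_derive_col => i.
pose gi (s : R) := g (Num.max 0 s) i 0.
have cgi : continuous gi by exact: continuous_coord.
have pE : forall s, 0 <= s -> p s i 0 = p 0 i 0 + prim gi s.
  apply: (ac_prim (f := fun s => p s i 0) cgi).
    move=> T T0; apply: (@abs_continuous_dominated _ _ _ _ _ 1 _ _ (pac T T0)) => r s _ _ _.
    by rewrite mul1r; have := normr_coord (p s - p r) i; rewrite !mxE.
  apply: aeS dp => s dps s0; rewrite /gi max_r ?ltW//; apply: is_derive_coord.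
  exact: dps.
have : is_derive t 1 (fun s => p 0 i 0 + prim gi s) (0 + gi t).
  by apply: is_deriveD; exact: prim_derive.
rewrite add0r {2}/gi max_r ?ltW//; apply: near_eq_is_derive.
by near=> s; rewrite (pE s)//; apply: ltW; near: s; exact: lt_nbhsr.
Unshelve. all: by end_near. Qed.

Lemma mulmx_continuous (A : 'M[R]_n.+1) p : continuous p -> continuous (fun t => A *m p t).
Proof.
move=> cp t; apply/(cvg_coordP (nbhs_filter t)) => i; rewrite mxE.
under eq_fun do rewrite mxE.
apply: cvg_big => //; first by exact: add_continuous.
by move=> j _; apply: cvgMr; exact: (@continuous_coord p j cp).
Qed.

Lemma extremal_lift_continuous x p : extremal_lift q F x p ->
  continuous (fun t : R => x (Num.max 0 t)) /\ continuous (fun t : R => p (Num.max 0 t)).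
Proof. by move=> [[xac _] [pac _]]; split; exact: loc_abs_continuous_max0. Qed.

Lemma extremal_lift_adjoint_derive x p : extremal_lift q F x p ->
  forall t : R, 0 < t -> is_derive t 1 p (- ((jordan n)^T *m p t) + gradient F (x t)).
Proof.
move=> H; have [cx cp] := extremal_lift_continuous H; have [_ [pac dp]] := H.
apply: ac_derive => //.
move=> t; apply: cvgD.
  by apply: cvgN; exact: (@mulmx_continuous _ (fun t => p (Num.max 0 t)) cp).
apply: (@continuous_comp _ _ _ (fun t : R => x (Num.max 0 t)) (gradient F)); first exact: cx.
exact: cF.2.
Qed.

Lemma continuous_spow_coord p : continuous (fun t : R => p (Num.max 0 t)) ->
  continuous (fun t : R => spow (p (Num.max 0 t) ord_max 0) (q - 1)^-1).
Proof.
move=> cp t; apply: (@continuous_comp _ _ _ (fun t : R => p (Num.max 0 t) ord_max 0) (fun a : R => spow a (q - 1)^-1)).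
  exact: (@continuous_coord (fun t : R => p (Num.max 0 t)) ord_max cp).
by apply: continuous_spow; rewrite invr_gt0.
Qed.

Lemma extremal_lift_state_derive x p : extremal_lift q F x p ->
  forall t : R, 0 < t ->
    is_derive t 1 x (jordan n *m x t + spow (p t ord_max 0) (q - 1)^-1 *: elast n).
Proof.
move=> H; have [cx cp] := extremal_lift_continuous H; have [[xac dx] _] := H.
apply: ac_derive => //.
move=> t; apply: cvgD; first exact: (@mulmx_continuous _ (fun t => x (Num.max 0 t)) cx).
by apply: cvgZr_tmp; exact: continuous_spow_coord.
Qed.

Lemma extremal_lift_unique x p p' : extremal_lift q F x p -> extremal_lift q F x p' ->
  forall t, 0 <= t -> p' t = p t.
Proof.
move=> H H'; have [cx cp] := extremal_lift_continuous H; have [_ cp'] := extremal_lift_continuous H'.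
have dp := extremal_lift_adjoint_derive H; have dp' := extremal_lift_adjoint_derive H'.
suff key k : (k <= n)%N -> forall t, 0 <= t -> p' t (inord (n - k)) 0 = p t (inord (n - k)) 0.
  move=> t t0; apply/colP => i; have := key (n - i)%N (leq_subr _ _) t t0.
  by rewrite subKn ?inord_val// -ltnS.
have cc (r : R -> 'cV[R]_n.+1) i : continuous (fun t : R => r (Num.max 0 t)) ->
    continuous (fun t : R => r (Num.max 0 t) i 0).
  by move=> cr; exact: (@continuous_coord (fun t => r (Num.max 0 t)) i cr).
elim: k => [_|k IH kn].
  have -> : inord (n - 0) = ord_max :> 'I_n.+1 by apply/val_inj; rewrite /= subn0 inordK.
  apply: (@ae_eq_continuous _ (fun t => p' t ord_max 0) (fun t => p t ord_max 0)); try exact: cc.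
  apply: aeW => t t0.
  have := @derive_val _ _ _ _ _ _ _ (extremal_lift_state_derive H' t0).
  rewrite (@derive_val _ _ _ _ _ _ _ (extremal_lift_state_derive H t0)) => /addrI/colP/(_ ord_max).
  rewrite ![(_ *: elast n) _ _]mxE elastE eqxx !mulr1 => E.
  by apply: (can_inj (spowK (_ : (q - 1)^-1 != 0))); rewrite ?invr_neq0 ?gt_eqF.
pose i : 'I_n.+1 := inord (n - k).
have iE : i = (n - k)%N :> nat by rewrite /i inordK// ltnS leq_subr.
have i0 : (0 < i)%N by rewrite iE subn_gt0.
have i1 : inord i.-1 = inord (n - k.+1) :> 'I_n.+1 by rewrite iE subnS.
rewrite -i1.
apply: (@ae_eq_continuous _ (fun t => p' t (inord i.-1) 0) (fun t => p t (inord i.-1) 0)); try exact: cc.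
apply: aeW => t t0.
have d := is_derive_coord i (dp t t0); have d' := is_derive_coord i (dp' t t0).
(* The coordinates [i] of both lifts agree near [t], so the derivative of one is also that of the
   other; the adjoint equation then compares the coordinates just below. *)
have dd : is_derive t 1 (fun s => p s i 0) ((- ((jordan n)^T *m p' t) + gradient F (x t)) i 0).
  apply: near_eq_is_derive d'; near=> s; apply: (IH (ltnW kn)).
  by apply: ltW; near: s; exact: lt_nbhsr.
have := @derive_val _ _ _ _ _ _ _ dd; rewrite (@derive_val _ _ _ _ _ _ _ d).
move=> E; have {E} : (- ((jordan n)^T *m p t)) i 0 = (- ((jordan n)^T *m p' t)) i 0.
  by move: E; move: (jordan n)^T => A; rewrite [LHS]mxE [RHS]mxE => /addIr.
by rewrite [LHS]mxE [RHS]mxE => /oppr_inj; rewrite !trjordanE i0.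
Unshelve. all: by end_near. Qed.

Lemma optimal_extremal_lift (x0 : 'cV[R]_n.+1) u x : optimal q F x0 u x ->
  exists p, extremal_lift q F x p.
Proof.
move=> opt; have [p [cp dp up]] := optimal_adjoint q1 cF vF pF opt.
have [_ hx _] := opt; have [_ [xac dx]] := hx.
exists p; split; split => //.
- by apply: aeS2 dx up => t dx ut t0; rewrite -ut//; exact: dx.
- move=> T T0; apply: C1_abs_continuous dp T0 => // t; apply: cvgD.
    by apply: cvgN; exact: mulmx_continuous.
  exact: continuous_gradient_max0 hx _.
- apply: aeW => t t0; have := dp t t0; rewrite max_r//; exact: ltW.
Qed.

(** The trajectory and the lift both give the derivative of the same [x]. Its last coordinate
    identifies the two controls almost everywhere, and continuity does the rest. *)
Lemma continuous_representative_unique (x0 : 'cV[R]_n.+1) u (ubar : R -> R) x p : trajectory x0 u x ->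
  continuous_representative u ubar -> extremal_lift q F x p ->
  forall t, 0 <= t -> ubar t = spow (p t ord_max 0) (q - 1)^-1.
Proof.
move=> [_ [_ dx]] [cu uu] H; have [cx cp] := extremal_lift_continuous H.
apply: (@ae_eq_continuous _ ubar (fun t => spow (p t ord_max 0) (q - 1)^-1)).
- exact: continuous_max0.
- exact: continuous_spow_coord.
apply: aeS2 uu dx => t ut dxt t0.
rewrite -ut; last by rewrite /= in_itv/= andbT ltW.
have := @derive_val _ _ _ _ _ _ _ (dxt t0).
rewrite (@derive_val _ _ _ _ _ _ _ (extremal_lift_state_derive H t0)) => /addrI/colP/(_ ord_max).
by rewrite ![(_ *: elast n) _ _]mxE elastE eqxx !mulr1.
Qed.

End extremal_lifts.

(** * Uniform bounds *)

Section window_estimates.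
Context {R : realType} {n : nat} (q : R) (F : 'cV[R]_n.+1 -> R).
Context (q1 : 1 < q) (cF : contdiff F) (vF : is_convex F) (pF : positive_definite F).
Implicit Types (x p : R -> 'cV[R]_n.+1).

Let q0 : 0 < q. Proof. exact: lt_trans q1. Qed.
Let q10 : 0 < q - 1. Proof. by rewrite subr_gt0. Qed.

Definition lift_control p (t : R) : R := spow (p t ord_max 0) (q - 1)^-1.

(** Built from the continuous control of the lift rather than from [u], so that it is differentiable
    at every positive time. *)
Definition energy x p : R -> R :=
  prim (fun s => running q F (lift_control p) x (Num.max 0 s)).

Lemma running_continuous x p : extremal_lift q F x p ->
  continuous (fun s : R => running q F (lift_control p) x (Num.max 0 s)).
Proof.
move=> H; have [cx cp] := extremal_lift_continuous H => t; apply: cvgD.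
  apply: cvgM; last exact: cvg_cst.
  apply: (@continuous_comp _ _ _ (fun s : R => lift_control p (Num.max 0 s)) (fun a : R => `|a| `^ q)).
    exact: (continuous_spow_coord q1 cp).
  exact: continuous_norm_powR.
exact: (continuous_comp_max0 (contdiff_continuous cF) cx).
Qed.

Lemma energy_derive x p : extremal_lift q F x p -> forall s : R, 0 < s ->
  is_derive s 1 (energy x p) (running q F (lift_control p) x s).
Proof.
move=> H s s0; have := prim_derive (running_continuous H) s0.
by rewrite max_r ?ltW.
Qed.

Lemma energy_continuous x p : extremal_lift q F x p -> continuous (energy x p).
Proof. by move=> H; exact: prim_continuous (running_continuous H). Qed.

Lemma energy_le x p : extremal_lift q F x p -> forall s t, 0 <= s -> s <= t ->
  energy x p s <= energy x p t.
Proof.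
move=> H s t s0 st; rewrite -subr_ge0.
have := @is_derive_le _ (fun=> 0) (fun=> 0) (energy x p) (running q F (lift_control p) x) s t st.
rewrite subrr normr0; apply.
- by move=> r; exact: cvg_cst.
- exact: energy_continuous.
- by move=> r /andP[sr _]; apply: energy_derive => //; exact: le_lt_trans sr.
- by move=> r _; exact: running_ge0.
Qed.

(** Above the threshold [r] the factor [|a| ^ (1 - q)] is at most [r ^ (1 - q)]. Thus the control is
    bounded by an arbitrarily small constant plus a multiple of its cost. *)
Lemma norm_le_powR (a r : R) : 0 < r -> `|a| <= r + r `^ (1 - q) * `|a| `^ q.
Proof.
move=> r0; have [ar|ar] := leP `|a| r.
  by rewrite ler_wpDr// mulr_ge0// powR_ge0.
apply: ler_wpDl; first exact: ltW.
rewrite -(mulr_powRB1 (normr_ge0 a) q0) mulrCA ler_peMr//.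
rewrite -(opprB q 1) powRN mulrC ler_pdivlMr ?powR_gt0// mul1r.
by rewrite ge0_ler_powR ?nnegrE ?(ltW q10) ?(ltW r0) ?(ltW ar).
Qed.

(** Same splitting with the threshold on [|a| ^ (q - 1)], which is the size of the last coordinate
    of [p] when [a] is the control of the lift. *)
Lemma powRB1_le (a r : R) : 0 < r -> `|a| `^ (q - 1) <= r + (r `^ (q - 1)^-1)^-1 * `|a| `^ q.
Proof.
move=> r0; have [ar|ar] := leP (`|a| `^ (q - 1)) r.
  by rewrite ler_wpDr// mulr_ge0 ?powR_ge0// invr_ge0 powR_ge0.
apply: ler_wpDl; first exact: ltW.
rewrite -(mulr_powRB1 (normr_ge0 a) q0) mulrA ler_peMl ?powR_ge0//.
rewrite mulrC ler_pdivlMr ?powR_gt0// mul1r.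
have -> : `|a| = (`|a| `^ (q - 1)) `^ (q - 1)^-1.
  by rewrite -powRrM mulfV ?gt_eqF// powRr1.
by rewrite ge0_ler_powR ?nnegrE ?powR_ge0 ?invr_ge0 ?(ltW q10) ?(ltW r0) ?(ltW ar).
Qed.

Lemma lift_controlE p t : `|lift_control p t| `^ (q - 1) = `|p t ord_max 0|.
Proof.
rewrite /lift_control normr_spow ?invr_neq0 ?gt_eqF// -powRrM mulVf ?gt_eqF//.
by rewrite powRr1.
Qed.

Lemma norm_lift_control p t : `|lift_control p t| = `|p t ord_max 0| `^ (q - 1)^-1.
Proof. by rewrite /lift_control normr_spow ?invr_neq0 ?gt_eqF. Qed.

Lemma state_window r : 0 < r -> exists2 K : R, 0 <= K & forall x p, extremal_lift q F x p ->
  forall t, 0 <= t -> `|x t| <= 3 * r + K * (energy x p (t + 1) - energy x p t).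
Proof.
move=> r0; have [c c0 hc] := convex_coercive cF vF pF r0.
(* The derivative of [f] involves two coordinates of size at most [|x|], or one and the control.
   Each [|x|] costs [r + F x / c] and the control costs [r] plus [r ^ (1 - q)] times its [q]-th
   power; the factor [q] undoes the division by [q] in the running cost. *)
pose K := 2 / c + q * r `^ (1 - q).
have K0 : 0 <= K by rewrite addr_ge0 ?mulr_ge0 ?invr_ge0 ?powR_ge0// ltW.
exists K => // x p H t t0; apply: normr_le_coord => i.
have [cx cp] := extremal_lift_continuous H.
pose f (s : R) := (t + 1 - s) * x (Num.max 0 s) i 0.
pose xn s : R := if (i < n)%N then x s (inord i.+1) 0 else lift_control p s.
have xnE s : (jordan n *m x s + lift_control p s *: elast n) i 0 = xn s.
  rewrite mxE jordanE [X in _ + X]mxE elastE /xn.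
  case: ltnP => ni; first by rewrite (ltn_eqF ni) mulr0 addr0.
  by rewrite add0r eqn_leq ni -ltnS ltn_ord mulr1.
have cx' : continuous (fun s : R => x (Num.max 0 s) i 0).
  exact: (@continuous_coord _ _ (fun s => x (Num.max 0 s)) i cx).
have df (s : R) : t < s < t + 1 -> is_derive s 1 f ((t + 1 - s) * xn s - x s i 0).
  move=> /andP[ts _]; have s0 : 0 < s by exact: le_lt_trans ts.
  have d1 : is_derive s 1 (fun r : R => t + 1 - r) (-1).
    have := is_deriveB (is_derive_cst (t + 1) s (1 : R)) (is_derive_id s (1 : R)).
    by rewrite sub0r.
  have d2 : is_derive s 1 (fun r : R => x (Num.max 0 r) i 0) (xn s).
    have := is_derive_coord i (extremal_lift_state_derive q1 H s0).
    rewrite xnE; apply: near_eq_is_derive; near=> y; rewrite max_r//.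
    by apply: ltW; near: y; exact: lt_nbhsr.
  have := is_deriveM d1 d2.
  by rewrite [_ *: -1]mulrN1 max_r// ltW.
have bound s : t < s < t + 1 ->
    `|(t + 1 - s) * xn s - x s i 0| <= 3 * r + K * running q F (lift_control p) x s.
  move=> /andP[ts st]; have h1 := hc (x s).
  have h2 := norm_le_powR (lift_control p s) r0.
  have h3 : `|xn s| <= `|x s| + `|lift_control p s|.
    by rewrite /xn; case: ifP => _; [rewrite ler_wpDr// normr_coord|rewrite ler_wpDl].
  have h4 : `|(t + 1 - s) * xn s| <= `|xn s|.
    by rewrite normrM ler_piMl// gtr0_norm; lra.
  have h5 := normr_coord (x s) i.
  have h6 := ler_normB ((t + 1 - s) * xn s) (x s i 0).
  have h7 : `|x s| <= r + c^-1 * F (x s) by rewrite -lerBlDl ler_pdivlMl.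
  have h8 : K * running q F (lift_control p) x s = 2 * (c^-1 * F (x s)) +
      r `^ (1 - q) * `|lift_control p s| `^ q +
      (q * r `^ (1 - q) * F (x s) + 2 / c * (`|lift_control p s| `^ q / q)).
    by rewrite /K /running; field; rewrite !gt_eqF.
  have h9 : 0 <= q * r `^ (1 - q) * F (x s) + 2 / c * (`|lift_control p s| `^ q / q).
    rewrite addr_ge0// ?mulr_ge0 ?invr_ge0 ?powR_ge0 ?(ltW q0) ?(ltW c0)//.
    exact: positive_definite_ge0.
  lra.
have dg (s : R) : t < s < t + 1 -> is_derive s 1 (fun s : R => 3 * r * s + K * energy x p s)
    (3 * r + K * running q F (lift_control p) x s).
  move=> /andP[ts _]; have s0 : 0 < s by exact: le_lt_trans ts.
  have := is_deriveD (is_deriveZ (3 * r) (is_derive_id s (1 : R)))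
    (is_deriveZ K (energy_derive H s0)).
  by rewrite [_ *: 1]mulr1.
have tt1 : t <= t + 1 by rewrite lerDl.
have cf : continuous f.
  move=> s; apply: cvgM; last exact: cx'.
  by apply: cvgB; [exact: cvg_cst|exact: cvg_id].
have cg : continuous (fun s : R => 3 * r * s + K * energy x p s).
  move=> s; apply: cvgD; apply: cvgMr; first exact: cvg_id.
  exact: energy_continuous.
have := is_derive_le tt1 cf cg df dg bound.
rewrite /f subrr mul0r sub0r normrN addrAC subrr add0r mul1r max_r//.
lra.
Unshelve. all: by end_near. Qed.

(** The order of quantifiers matters: [K0] depends only on the steering polynomials, so [r] and [G]
    can be chosen afterwards to make [K0 * (r + G)] small. *)
Lemma adjoint_window : exists2 K0 : R, 0 <= K0 & forall r, 0 < r -> exists2 K : R, 0 <= K &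
  forall x p, extremal_lift q F x p -> forall t G : R, 0 <= t ->
    (forall s, t < s < t + 1 -> `|gradient F (x s)| <= G) ->
    `|p t| <= K0 * (r + G) + K * (energy x p (t + 1) - energy x p t).
Proof.
have [phi hphi] := @steering_polys R n.
(* The index ranges over [n + 2] values because the derivative of order [n + 1] occurs too. *)
have /fin_all_exists[M hM] : forall j : 'I_n.+1, exists M : R, 0 <= M /\
    forall (i : 'I_n.+2) (s : R), 0 <= s <= 1 -> `|(phi j)^`(i).[s]| <= M.
  move=> j; have /fin_all_exists[B hB] : forall i : 'I_n.+2, exists B : R, 0 <= B /\
      forall s : R, 0 <= s <= 1 -> `|(phi j)^`(i).[s]| <= B.
    by move=> i; have [B B0 hB] := horner_bounded (phi j)^`(i) (@ler01 R); exists B.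
  exists (\sum_i B i); split; first by apply: sumr_ge0 => i _; have [] := hB i.
  move=> i s s01; apply: le_trans ((hB i).2 s s01) _.
  by rewrite (bigD1 i)//= lerDl sumr_ge0// => k _; have [] := hB k.
have M0 j : 0 <= M j by have [] := hM j.
pose K0 := (\sum_j M j) * n.+1%:R.
have K00 : 0 <= K0 by rewrite mulr_ge0// sumr_ge0.
exists K0 => // r r0; pose d := (r `^ (q - 1)^-1)^-1.
have d0 : 0 <= d by rewrite invr_ge0 powR_ge0.
(* [d] is the factor of [powRB1_le], and [q] undoes the division by [q] in the running cost. *)
exists (K0 * (d * q)); first exact: (mulr_ge0 K00 (mulr_ge0 d0 (ltW q0))).
move=> x p H t G t0 hG; apply: normr_le_coord => j.
have [cx cp] := extremal_lift_continuous H.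
pose f (s : R) := \sum_i p (Num.max 0 s) i 0 * (phi j)^`(i).[s - t].
pose df (s : R) := p s ord_max 0 * (phi j)^`(n.+1).[s - t] +
  \sum_i gradient F (x s) i 0 * (phi j)^`(i).[s - t].
have dfE (s : R) : t < s < t + 1 -> is_derive s 1 f (df s).
  move=> /andP[ts _]; have s0 : 0 < s by exact: le_lt_trans ts.
  have := adjoint_poly_derive (phi j) t (extremal_lift_adjoint_derive cF H s0).
  apply: near_eq_is_derive; near=> y; apply: eq_bigr => i _; rewrite max_r//.
  by apply: ltW; near: y; exact: lt_nbhsr.
have bound s : t < s < t + 1 ->
    `|df s| <= K0 * (r + G) + K0 * (d * q) * running q F (lift_control p) x s.
  move=> st; have s01 : 0 <= s - t <= 1.
    by case/andP: st => st1 st2; apply/andP; split; lra.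
  have G0 : 0 <= G by apply: le_trans (hG s st).
  have pM : `|p s ord_max 0 * (phi j)^`(n.+1).[s - t]| <= `|p s ord_max 0| * M j.
    by rewrite normrM ler_wpM2l//; exact: ((hM j).2 ord_max).
  have gM : `|\sum_i gradient F (x s) i 0 * (phi j)^`(i).[s - t]| <= n.+1%:R * (G * M j).
    apply: le_trans (ler_norm_sum _ _ _) _.
    apply: (@le_trans _ _ (\sum_(i < n.+1) G * M j)); last first.
      by rewrite mulr_natl sumr_const card_ord.
    apply: ler_sum => i _; rewrite normrM ler_pM//.
      exact: le_trans (normr_coord _ _) (hG s st).
    exact: ((hM j).2 (widen_ord (leqnSn _) i)).
  have pE : `|p s ord_max 0| <= r + d * q * running q F (lift_control p) x s.
    rewrite -lift_controlE; apply: le_trans (powRB1_le _ r0) _.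
    rewrite lerD2l -mulrA ler_wpM2l// /running mulrDr mulrCA mulfV ?gt_eqF// mulr1.
    by rewrite lerDl mulr_ge0 ?(ltW q0)//; exact: positive_definite_ge0.
  have n1 : 1 <= n.+1%:R :> R by rewrite ler1n.
  have MK : M j * n.+1%:R <= K0.
    by rewrite ler_wpM2r// (bigD1 j)//= lerDl sumr_ge0.
  apply: le_trans (ler_normD _ _) _; apply: le_trans (lerD pM gM) _.
  move: pE; set e := d * q * _ => pE.
  have re0 : 0 <= r + e by exact: le_trans pE.
  have a1 : `|p s ord_max 0| * M j <= (r + e) * M j by rewrite ler_wpM2r.
  have a2 : (r + e) * M j <= n.+1%:R * ((r + e) * M j) by rewrite ler_peMl// mulr_ge0.
  have a3 : M j * n.+1%:R * (r + e + G) <= K0 * (r + e + G) by rewrite ler_wpM2r// addr_ge0.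
  rewrite -[K0 * (d * q) * _]mulrA -/e.
  lra.
have dg (s : R) : t < s < t + 1 -> is_derive s 1
    (fun s : R => K0 * (r + G) * s + K0 * (d * q) * energy x p s)
    (K0 * (r + G) + K0 * (d * q) * running q F (lift_control p) x s).
  move=> /andP[ts _]; have s0 : 0 < s by exact: le_lt_trans ts.
  have := is_deriveD (is_deriveZ (K0 * (r + G)) (is_derive_id s (1 : R)))
    (is_deriveZ (K0 * (d * q)) (energy_derive H s0)).
  by rewrite [_ *: 1]mulr1.
have tt1 : t <= t + 1 by rewrite lerDl.
have cf : continuous f.
  move=> s; apply: cvg_big => //; first by exact: add_continuous.
  move=> i _; apply: cvgM; first exact: (@continuous_coord _ _ (fun s => p (Num.max 0 s)) i cp).
  apply: (@continuous_comp _ _ _ (fun s : R => s - t) (horner (phi j)^`(i))).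
    by apply: cvgB; [exact: cvg_id|exact: cvg_cst].
  exact: continuous_horner.
have cg : continuous (fun s : R => K0 * (r + G) * s + K0 * (d * q) * energy x p s).
  move=> s; apply: cvgD; apply: cvgMr; first exact: cvg_id.
  exact: energy_continuous.
have := is_derive_le tt1 cf cg dfE dg bound.
have -> : f (t + 1) = 0.
  apply: big1 => i _; rewrite addrAC subrr add0r (root_derivn (hphi j).1)// mulr0//.
have -> : f t = p t j 0.
  rewrite /f subrr max_r// (bigD1 j)//= (hphi j).2 eqxx mulr1 big1 ?addr0// => i ij.
  by rewrite (hphi j).2 (negPf ij) mulr0.
rewrite sub0r normrN; lra.
Unshelve. all: by end_near. Qed.

End window_estimates.

(** * Bounds and decay of lifts from the energy spent in unit windows *)

Section optimal_bounds.
Context {R : realType} {n : nat} (q : R) (F : 'cV[R]_n.+1 -> R).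
Context (q1 : 1 < q) (cF : contdiff F) (vF : is_convex F) (pF : positive_definite F).
Local Notation mu := (@lebesgue_measure R).
Local Notation D := (`[0%R, +oo[%classic : set R).
Implicit Types (x p : R -> 'cV[R]_n.+1) (u : R -> R).

Let q0 : 0 < q. Proof. exact: lt_trans q1. Qed.
Let q10 : 0 < q - 1. Proof. by rewrite subr_gt0. Qed.

Lemma trajectory_control_ae (x0 : 'cV[R]_n.+1) u x p : trajectory x0 u x ->
  extremal_lift q F x p -> {ae mu, forall t, D t -> u t = lift_control q p t}.
Proof.
move=> [_ [_ dx]] H.
(* The state equation is only available for positive times, whereas [D] contains 0. *)
have n0 : {ae mu, forall t : R, t != 0}.
  exists [set 0]; split => //; first exact: lebesgue_measure_set1.
  by move=> t /= /negP/negPn/eqP.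
apply: aeS2 dx n0 => t dxt tn0 /=; rewrite in_itv/= andbT le_eqVlt eq_sym (negPf tn0)/= => t0.
have := @derive_val _ _ _ _ _ _ _ (dxt t0).
rewrite (@derive_val _ _ _ _ _ _ _ (extremal_lift_state_derive q1 H t0)) => /addrI/colP/(_ ord_max).
by rewrite ![(_ *: elast n) _ _]mxE elastE eqxx !mulr1 => <-.
Qed.

Lemma energy_le_cost (x0 : 'cV[R]_n.+1) u x p V : admissible q u -> trajectory x0 u x ->
  extremal_lift q F x p -> (cost q F u x <= V%:E)%E -> forall T, 0 <= T -> energy q F x p T <= V.
Proof.
move=> hu hx H cV T T0; rewrite -lee_fin; apply: le_trans cV.
have sD : `[0%R, T]%classic `<=` D by exact: subset_itvl.
have cr := running_continuous q1 cF H.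
rewrite -(prim_integral cr T0).
have mr := running_measurable cF hu hx.
have -> : (\int[mu]_(t in `[0%R, T]) (running q F (lift_control q p) x (Num.max 0 t))%:E =
    \int[mu]_(t in `[0%R, T]) (running q F u x t)%:E)%E.
  apply: ae_eq_integral => //.
  - by apply/measurable_EFinP; apply: measurable_funTS; exact: continuous_measurable_fun.
  - by apply/measurable_EFinP; apply: measurable_funS mr.
  - apply: aeS (trajectory_control_ae hx H) => t ut tT; have Dt := sD t tT.
    rewrite max_r; first by rewrite /running ut.
    by move: Dt; rewrite /= in_itv/= andbT.
apply: ge0_subset_integral => //; first by apply/measurable_EFinP.
by move=> t _; rewrite lee_fin; exact: running_ge0.
Qed.

Lemma optimal_cost_bounded (rho : R) : exists2 V : R, 0 <= V &
  forall (x0 : 'cV[R]_n.+1) u x, `|x0| <= rho -> optimal q F x0 u x -> (cost q F u x <= V%:E)%E.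
Proof.
have [K K0 hK] := steering_cost q1 cF pF.
have [M hM] := continuous_bounded_ball (K * rho) (contdiff_continuous cF).
exists ((K * rho) `^ q / q + `|M|).
  by rewrite addr_ge0// divr_ge0 ?powR_ge0// ltW.
move=> x0 u x x0r opt; have [v [y [hy y0 hV]]] := hK x0.
have Kr : K * `|x0| <= K * rho by rewrite ler_wpM2l.
apply: (@le_trans _ _ ((K * `|x0|) `^ q / q + `|M|)%:E).
  apply: optimal_cost_le hy y0 _ opt => //; apply: hV => z zK.
  apply: le_trans (ler_norm _) _; apply: le_trans (ler_norm M).
  by apply: hM; exact: le_trans Kr.
rewrite lee_fin lerD2r ler_pM2r ?invr_gt0// ge0_ler_powR ?nnegrE ?(ltW q0)// ?mulr_ge0//.
exact: le_trans x0r.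
Qed.

Lemma optimal_cost_small (d : R) : 0 < d -> exists2 h : R, 0 < h &
  forall (x0 : 'cV[R]_n.+1) u x, `|x0| <= h -> optimal q F x0 u x -> (cost q F u x <= d%:E)%E.
Proof.
move=> d0; have [K K0 hK] := steering_cost q1 cF pF.
have d2 : 0 < d / 2 by rewrite divr_gt0.
have [a a0 ha] : exists2 a : R, 0 < a & forall b, 0 <= b -> b < a -> b `^ q / q <= d / 2.
  have := @continuous_norm_powR R q q0 0; rewrite /continuous_at normr0 powR0 ?gt_eqF//.
  have dq : 0 < q * (d / 2) by rewrite mulr_gt0.
  move=> /cvgrPdist_le/(_ _ dq)[a /= a0 ha]; exists a => // b b0 ba.
  have := ha b; rewrite /ball_/= !sub0r !normrN norm_powR ?normr_ge0// !normr_id ger0_norm//.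
  by move=> /(_ ba); rewrite ler_pdivrMr// mulrC.
have [c c0 hc] : exists2 c : R, 0 < c & forall z, `|z| < c -> F z <= d / 2.
  have := @contdiff_continuous _ _ _ cF 0; rewrite /continuous_at pF.1.
  move=> /cvgrPdist_le/(_ _ d2)/nbhs_ballP[c /= c0 hc]; exists c => // z zc.
  have := hc z; rewrite -ball_normE /ball_/= !sub0r !normrN => /(_ zc).
  exact: le_trans (ler_norm _).
pose m := Num.min a c; have m0 : 0 < m by rewrite lt_min a0.
have K1 : 0 < K + 1 by rewrite ltr_wpDl.
(* This radius forces [K * |x0| < m]; adding 1 avoids division by zero when [K = 0]. *)
exists (m / 2 / (K + 1)); first by rewrite !divr_gt0.
move=> x0 u x x0h opt; have [v [y [hy y0 hV]]] := hK x0.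
have Km : K * `|x0| < m.
  apply: (@le_lt_trans _ _ (m / 2)).
    apply: (@le_trans _ _ ((K + 1) * `|x0|)); first by rewrite ler_wpM2r// lerDl.
    by rewrite mulrC -ler_pdivlMr.
  by rewrite ltr_pdivrMr// ltr_pMr// ltr1n.
apply: (@le_trans _ _ ((K * `|x0|) `^ q / q + d / 2)%:E).
  apply: optimal_cost_le hy y0 _ opt => //; apply: hV => z zK.
  apply: hc; apply: le_lt_trans zK _; apply: lt_le_trans Km _.
  by rewrite /m ge_min lexx orbT.
rewrite lee_fin [leRHS](splitr d) lerD2r; apply: ha; first by rewrite mulr_ge0.
by apply: lt_le_trans Km _; rewrite /m ge_min lexx.
Qed.

Lemma continuous_normr_gradient : continuous (fun z : 'cV[R]_n.+1 => `|gradient F z|).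
Proof.
move=> z; apply: (@continuous_comp _ _ _ (gradient F) (fun w => `|w|)); first exact: cF.2.
exact: norm_continuous.
Qed.

Lemma lift_bounded (A : R) : exists2 B : R, 0 <= B & forall x p, extremal_lift q F x p ->
  (forall t, 0 <= t -> energy q F x p (t + 1) - energy q F x p t <= A) ->
  forall t, 0 <= t -> [/\ `|x t| <= B, `|p t| <= B & `|lift_control q p t| <= B].
Proof.
have [K K0 hK] := state_window q1 cF vF pF ltr01.
have [K1 K10 hK1] := adjoint_window q1 cF pF.
have [K2 K20 hK2] := hK1 1 ltr01.
pose X := 3 * 1 + K * A.
have [G hG] := continuous_bounded_ball X continuous_normr_gradient.
pose P := K1 * (1 + G) + K2 * A.
exists (`|X| + `|P| + `|P| `^ (q - 1)^-1); first by rewrite !addr_ge0 ?powR_ge0.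
move=> x p H hA; have xX t : 0 <= t -> `|x t| <= X.
  move=> t0; apply: le_trans (hK _ _ H t t0) _.
  by rewrite lerD2l ler_wpM2l// hA.
have pP t : 0 <= t -> `|p t| <= P.
  move=> t0; apply: le_trans (hK2 _ _ H t G t0 _) _; last by rewrite lerD2l ler_wpM2l// hA.
  move=> s /andP[ts _]; rewrite -[leLHS]normr_id; apply: hG; apply: xX.
  by rewrite (le_trans t0)// ltW.
move=> t t0; have Xt := le_trans (xX t t0) (ler_norm X); have Pt := le_trans (pP t t0) (ler_norm P).
split.
- by apply: le_trans Xt _; rewrite -addrA lerDl addr_ge0// powR_ge0.
- by apply: le_trans Pt _; rewrite addrAC lerDr addr_ge0// powR_ge0.
- apply: (@le_trans _ _ (`|P| `^ (q - 1)^-1)); last by rewrite lerDr addr_ge0.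
  rewrite (norm_lift_control q1) ge0_ler_powR ?nnegrE ?invr_ge0 ?(ltW q10)//.
  exact: le_trans (normr_coord _ _) Pt.
Qed.

(** Tolerances are chosen backwards: the control is small once [p] is, [p] once the gradient and the
    window energy are, and the gradient once [x] is. With [T = 0] this serves small initial states,
    with large [T] the limit at infinity. *)
Lemma lift_small (e : R) : 0 < e -> exists2 d : R, 0 < d & forall x p, extremal_lift q F x p ->
  forall T, 0 <= T ->
  (forall t, T <= t -> energy q F x p (t + 1) - energy q F x p t <= d) ->
  forall t, T <= t -> [/\ `|x t| <= e, `|p t| <= e & `|lift_control q p t| <= e].
Proof.
move=> e0.
have [e1 e10 [e1e he1]] : exists2 e1 : R, 0 < e1 & e1 <= e /\
    forall b, 0 <= b -> b <= e1 -> b `^ (q - 1)^-1 <= e.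
  have q10' : 0 < (q - 1)^-1 by rewrite invr_gt0.
  have := @continuous_norm_powR R _ q10' 0; rewrite /continuous_at normr0 powR0 ?gt_eqF//.
  move=> /cvgrPdist_le/(_ _ e0)[a /= a0 ha]; exists (Num.min e (a / 2)).
    by rewrite lt_min e0 divr_gt0.
  split; first by rewrite ge_min lexx.
  move=> b b0; rewrite le_min => /andP[_ ba].
  have := ha b; rewrite /ball_/= !sub0r !normrN norm_powR ?normr_ge0// !normr_id ger0_norm//.
  by apply; apply: le_lt_trans ba _; rewrite ltr_pdivrMr// ltr_pMr// ltr1n.
have [K1 K10 hK1] := adjoint_window q1 cF pF.
(* In the bound on [p], two quarters of [e1] go to [K1 * (r1 + r1)], where the second [r1] bounds
   the gradient, and one quarter to the energy. *)
have K11 : 0 < K1 + 1 by rewrite ltr_wpDl.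
pose r1 := e1 / 4 / (K1 + 1); have r10 : 0 < r1 by rewrite !divr_gt0.
have K1r : K1 * r1 <= e1 / 4.
  by rewrite /r1 mulrCA ler_piMr ?ler_pdivrMr ?mul1r ?lerDl// ltW// divr_gt0.
have [K2 K20 hK2] := hK1 r1 r10.
have [a a0 ha] : exists2 a : R, 0 < a & forall z, `|z| <= a -> `|gradient F z| <= r1.
  have := @continuous_normr_gradient 0; rewrite /continuous_at (gradient0 cF pF) normr0.
  move=> /cvgrPdist_le/(_ _ r10)/nbhs_ballP[a /= a0 ha]; exists (a / 2); first by rewrite divr_gt0.
  move=> z za; have := ha z; rewrite -ball_normE /ball_/= !sub0r !normrN normr_id; apply.
  by apply: le_lt_trans za _; rewrite ltr_pdivrMr// ltr_pMr// ltr1n.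
pose X := Num.min e a; have X0 : 0 < X by rewrite lt_min e0.
(* The state bound loses three times its parameter, here half of [X]; the energy takes the other
   half. *)
have X6 : 0 < X / 6 by rewrite divr_gt0.
have [K K0 hK] := state_window q1 cF vF pF X6.
have small (L c : R) : 0 <= L -> 0 < c -> L * (c / (L + 1)) <= c.
  move=> L0 c0; have L1 : 0 < L + 1 by rewrite ltr_wpDl.
  by rewrite mulrCA ler_piMr ?ler_pdivrMr ?mul1r ?lerDl// ltW.
pose d1 := X / 2 / (K + 1); pose d2 := e1 / 4 / (K2 + 1).
have d10 : 0 < d1 by rewrite !divr_gt0// ltr_wpDl.
have d20 : 0 < d2 by rewrite !divr_gt0// ltr_wpDl.
exists (Num.min d1 d2); first by rewrite lt_min d10.
move=> x p H T T0 hA.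
have xX t : T <= t -> `|x t| <= X.
  move=> Tt; apply: le_trans (hK _ _ H t (le_trans T0 Tt)) _.
  have : K * (energy q F x p (t + 1) - energy q F x p t) <= X / 2.
    apply: le_trans (small K (X / 2) K0 _); last by rewrite divr_gt0.
    by rewrite ler_wpM2l// (le_trans (hA t Tt))// ge_min lexx.
  by lra.
have pP t : T <= t -> `|p t| <= e1.
  move=> Tt; have t0 := le_trans T0 Tt.
  have := hK2 _ _ H t r1 t0; move=> /(_ _)/wrap[].
    move=> s /andP[ts _]; apply: ha; apply: (@le_trans _ _ X).
      by apply: xX; rewrite (le_trans Tt)// ltW.
    by rewrite ge_min lexx orbT.
  have : K2 * (energy q F x p (t + 1) - energy q F x p t) <= e1 / 4.
    apply: le_trans (small K2 (e1 / 4) K20 _); last by rewrite divr_gt0.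
    by rewrite ler_wpM2l// (le_trans (hA t Tt))// ge_min lexx orbT.
  by lra.
move=> t Tt; split.
- by apply: le_trans (xX t Tt) _; rewrite ge_min lexx.
- exact: le_trans (pP t Tt) e1e.
- rewrite (norm_lift_control q1); apply: he1 => //.
  exact: le_trans (normr_coord _ _) (pP t Tt).
Qed.

(** Once [E] is within [d] of its supremum, no later increment can exceed [d]. *)
Lemma nondecreasing_bounded_increment (E : R -> R) (V d : R) : 0 < d ->
  (forall s t, 0 <= s -> s <= t -> E s <= E t) -> (forall t, 0 <= t -> E t <= V) ->
  exists2 T, 0 <= T & forall t, T <= t -> E (t + 1) - E t <= d.
Proof.
move=> d0 Em EV; pose S := [set E t | t in `[0, +oo[%classic].
have hS : has_sup S.
  split; first by exists (E 0), 0 => //=; rewrite in_itv/= lexx.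
  by exists V => _ [t /= + <-]; rewrite in_itv/= andbT => /EV.
have [_ [T /= + <-] ET] := sup_adherent d0 hS.
rewrite in_itv/= andbT => T0; exists T => // t Tt.
have t0 := le_trans T0 Tt.
have h1 : E (t + 1) <= sup S.
  by apply: (sup_upper_bound hS); exists (t + 1) => //=; rewrite in_itv/= andbT addr_ge0.
have h2 := Em _ _ T0 Tt; lra.
Qed.

End optimal_bounds.

(** * Majorants of class K-infinity for nondecreasing functions *)

Section K_infinity_majorant.
Context {R : realType}.
Local Notation mu := (@lebesgue_measure R).
Context (M : R -> R) (M0 : forall r, 0 <= M r) (Mm : forall r s, r <= s -> M r <= M s).

Let G (t : R) : R := \int[mu]_(s in `[0, t]) M s.

Let intM (a b : R) : mu.-integrable `[a, b] (EFin \o M).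
Proof.
have [ab|ba] := leP a b; last first.
  by rewrite set_itv_ge ?bnd_simp -?ltNge//; exact: integrable_set0.
apply: (@integrable_dominated _ _ _ (fun=> M b)) => //.
- by apply: nondecreasing_measurable => // r s rs; exact: Mm.
- by apply: (@continuous_integrable _ (fun=> M b)) => t; exact: cvg_cst.
- by move=> t /=; rewrite in_itv/= => /andP[_ tb]; rewrite ger0_norm ?Mm.
Qed.

Let G_increment (a b : R) : 0 <= a -> a <= b ->
  M a * (b - a) <= G b - G a <= M b * (b - a).
Proof.
move=> a0 ab.
have cst_int (c : R) : \int[mu]_(s in `]a, b]) c = c * (b - a).
  rewrite Rintegral_cst//= lebesgue_measure_itv/= lte_fin; case: ltP => //= ba.
  have -> : b = a by apply/eqP; rewrite eq_le ab ba.
  by rewrite subrr.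
have cst_integrable (c : R) : mu.-integrable `]a, b] (EFin \o (fun=> c)).
  apply: (@integrableS _ _ _ mu `[a, b]) => //; first exact: subset_itv_oc_cc.
  by apply: (@continuous_integrable _ (fun=> c)) => t; exact: cvg_cst.
have iM : mu.-integrable `]a, b] (EFin \o M).
  by apply: (@integrableS _ _ _ mu `[a, b]) => //; exact: subset_itv_oc_cc.
have -> : G b - G a = \int[mu]_(s in `]a, b]) M s.
  by rewrite /G Rintegral_itvB.
rewrite -!cst_int; apply/andP; split; apply: le_Rintegral => // t /=;
  rewrite in_itv/= => /andP[at_ tb]; apply: Mm => //; exact: ltW.
Qed.

(* r plus the mean of M over [r, 2 r]; C 0 = 0 because 0^-1 = 0. *)
Let C (r : R) : R := r + r^-1 * (G (2 * r) - G r).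

Let C_bounds (r : R) : 0 < r -> r + M r <= C r <= r + M (2 * r).
Proof.
move=> r0; have [||h1 h2] := andP (@G_increment r (2 * r) _ _); try lra.
move: h1 h2; rewrite [2 * r - r](_ : _ = r); last by lra.
by move=> h1 h2; rewrite /C !lerD2l ler_pdivlMl// ler_pdivrMl// ![r * _]mulrC h1.
Qed.

(** The term [r] gives strictness, so the mean over [[r, 2 r]] need only be nondecreasing. If the
    windows of [r] and [s] do not overlap, a value of [M] between them separates the means;
    otherwise the primitive is cut at [r < s < 2 r < 2 s]. *)
Let C_lt (r s : R) : 0 < r -> r < s -> C r < C s.
Proof.
move=> r0 rs; have s0 := lt_trans r0 rs; rewrite /C; apply: ltr_leD => //.
have [sr|sr] := leP (2 * r) s.
  have := C_bounds r0; have := C_bounds s0; rewrite /C !lerD2l => /andP[h1 _] /andP[_ h2].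
  by apply: le_trans h2 (le_trans _ h1); exact: Mm.
have g1 := G_increment (ltW r0) (ltW rs).
have g2 := G_increment (ltW s0) (ltW sr).
have r2 : 0 <= 2 * r by lra. have rs2 : 2 * r <= 2 * s by lra.
have g3 := G_increment r2 rs2.
rewrite ler_pdivrMl// mulrCA ler_pdivlMl//.
case/andP: g1 => _ g1; case/andP: g2 => _ g2; case/andP: g3 => g3 _.
have sr0 : 0 < s - r by rewrite subr_gt0.
(* The level [M (2 * r)] bounds [M] from above on the first two pieces and from below on the last,
   and with these values the required inequality is an equality. *)
have k1 : s * (G s - G r) <= s * (M (2 * r) * (s - r)).
  by rewrite ler_pM2l// (le_trans g1)// ler_pM2r//; apply: Mm; exact: ltW.
have k2 : (s - r) * (G (2 * r) - G s) <= (s - r) * (M (2 * r) * (2 * r - s)) by rewrite ler_pM2l.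
have k3 : r * (M (2 * r) * (2 * s - 2 * r)) <= r * (G (2 * s) - G (2 * r)) by rewrite ler_pM2l.
lra.
Qed.

Let G_continuous (t : R) : 0 < t -> {for t, continuous G}.
Proof.
move=> t0; apply/cvgrPdist_le => e e0.
pose L := M (2 * t) + 1; have L0 : 0 < L by rewrite ltr_wpDl.
have key (a b : R) : 0 <= a -> a <= b -> b <= 2 * t -> `|G b - G a| <= L * (b - a).
  move=> a0 ab bt; have /andP[h1 h2] := G_increment a0 ab.
  have ba0 : 0 <= b - a by rewrite subr_ge0.
  rewrite ger0_norm; last by apply: le_trans h1; rewrite mulr_ge0.
  apply: le_trans h2 _; rewrite ler_wpM2r// /L; have := Mm bt; lra.
have tL : 0 < Num.min t (e / L) by rewrite lt_min t0 divr_gt0.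
exists (Num.min t (e / L)) => //= s; rewrite /ball_/= lt_min => /andP[st sL].
have s0 : 0 <= s by move: st; rewrite ltr_norml => /andP[]; lra.
have s2 : s <= 2 * t by move: st; rewrite ltr_norml => /andP[]; lra.
apply: (@le_trans _ _ (L * `|t - s|)); last first.
  by rewrite mulrC -ler_pdivlMr// ltW.
have [ts|ts] := leP t s.
  by rewrite distrC [`|t - s|]distrC (ger0_norm (x := s - t)) ?subr_ge0//; apply: key => //; exact: ltW.
by rewrite (gtr0_norm (x := t - s)) ?subr_gt0//; apply: key => //; [exact: ltW|lra].
Qed.

(** Averaging removes the possible jumps of [M] at positive times; smallness of [M] near 0 gives
    continuity there and forces [M 0 = 0]. *)
Lemma K_infinity_majorant : (forall e, 0 < e -> exists2 h, 0 < h & M h <= e) ->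
  exists2 C : R -> R, K_infinity C & forall r, 0 <= r -> M r <= C r.
Proof.
move=> Msmall; have C0 : C 0 = 0 by rewrite /C invr0 mul0r addr0.
exists C; last first.
  move=> r; rewrite le_eqVlt => /predU1P[<-|r0]; last first.
    by case/andP: (C_bounds r0) => + _; lra.
  rewrite C0; apply/ler_addgt0Pl => e e0; have [h h0 he] := Msmall _ e0.
  by rewrite addr0 (le_trans _ he)//; apply: Mm; exact: ltW.
have Cpos (r : R) : 0 < r -> r <= C r.
  by move=> r0; case/andP: (C_bounds r0) => + _; have := M0 r; lra.
split => //.
- apply/continuous_within_itvcyP; split.
    move=> r; rewrite in_itv/= andbT => r0; apply: cvgD; first exact: cvg_id.
    apply: cvgM; first by apply: cvgV; [rewrite gt_eqF|exact: cvg_id].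
    apply: cvgB; last exact: G_continuous.
    apply: (@continuous_comp _ _ _ (fun r : R => 2 * r) G); first by apply: cvgMr; exact: cvg_id.
    by apply: G_continuous; rewrite mulr_gt0.
  rewrite C0; apply/cvgrPdist_le => e e0; have [|h h0 he] := Msmall (e / 2).
    by rewrite divr_gt0.
  exists (Num.min (h / 2) (e / 2)); first by rewrite /= lt_min !divr_gt0.
  move=> r /=; rewrite sub0r normrN lt_min => /andP[rh re] r0.
  rewrite sub0r normrN ger0_norm; last by rewrite (le_trans (ltW r0)) ?Cpos.
  case/andP: (C_bounds r0) => _ h2; rewrite gtr0_norm// in rh re.
  have : M (2 * r) <= M h by apply: Mm; lra.
  by lra.
- move=> r s; rewrite le_eqVlt => /predU1P[<- s0|]; last exact: C_lt.
  by rewrite C0 (lt_le_trans s0)// Cpos.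
- move=> B; exists (`|B| + 1); first by rewrite addr_ge0.
  apply: (@lt_le_trans _ _ (`|B| + 1)); last by apply: Cpos; rewrite ltr_wpDl.
  by rewrite ltr_pwDr// ler_norm.
Qed.

End K_infinity_majorant.

Section euclidean_norm.
Context {R : realType}.

Lemma normr_le_euclidean_norm m (v : 'cV[R]_m.+1) : `|v| <= euclidean_norm v.
Proof.
apply: normr_le_coord => i; rewrite -sqrtr_sqr ler_wsqrtr// (bigD1 i)//= lerDl.
by apply: sumr_ge0 => j _; exact: sqr_ge0.
Qed.

(** The factor [m] is cruder than its square root but suffices; it is absorbed into the bound [C]
    through a constant [c]. *)
Lemma euclidean_norm_le_coord m (v : 'cV[R]_m) (K : R) : 0 <= K ->
  (forall i, `|v i 0| <= K) -> euclidean_norm v <= m%:R * K.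
Proof.
move=> K0 vK; have mK : 0 <= m%:R * K by rewrite mulr_ge0.
rewrite -[leRHS](ger0_norm mK) -sqrtr_sqr ler_wsqrtr//.
apply: (@le_trans _ _ (\sum_(i < m) K ^+ 2)).
  by apply: ler_sum => i _; rewrite -real_normK ?num_real// lerXn2r ?nnegrE.
rewrite exprMn sumr_const card_ord -[leLHS]mulr_natl ler_wpM2r ?sqr_ge0//.
by case: m {v vK mK} => [|m]; rewrite ?expr2 ?mulr0// ler_peMl// ler1n.
Qed.

End euclidean_norm.

(** * The uniform bound over all initial states, and the limit *)

Section uniform_bound.
Context {R : realType} {n : nat} (q : R) (F : 'cV[R]_n.+1 -> R).
Context (q1 : 1 < q) (cF : contdiff F) (vF : is_convex F) (pF : positive_definite F).
Implicit Types (x p : R -> 'cV[R]_n.+1) (u : R -> R).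

Lemma optimal_energy_le (x0 : 'cV[R]_n.+1) u x p V : optimal q F x0 u x ->
  extremal_lift q F x p -> (cost q F u x <= V%:E)%E ->
  forall t, 0 <= t -> energy q F x p (t + 1) - energy q F x p t <= V.
Proof.
move=> [hu hx _] H cV t t0.
have t10 : 0 <= t + 1 by rewrite addr_ge0.
apply: (@le_trans _ _ (energy q F x p (t + 1))).
  rewrite gerBl; have := energy_le q1 cF pF H (lexx 0) t0.
  by rewrite {1}/energy prim_le0.
exact: (energy_le_cost q1 cF pF hu hx H cV).
Qed.

Definition lift_size x p t : R := `|x t| + `|p t| + `|lift_control q p t|.

Lemma optimal_uniform_bound (c : R) : 0 < c -> exists2 C : R -> R, K_infinity C &
  forall (x0 : 'cV[R]_n.+1) u x p t, optimal q F x0 u x -> extremal_lift q F x p ->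
    0 <= t -> c * lift_size x p t <= C (euclidean_norm x0).
Proof.
(* Adjoining 0 makes the supremum nonnegative and the set nonempty, without appeal to the existence
   of an optimal pair. *)
move=> c0; pose S (r : R) : set R := [set 0] `|` [set z | exists (x0 : 'cV[R]_n.+1) u x p t,
  [/\ euclidean_norm x0 <= r, optimal q F x0 u x, extremal_lift q F x p, 0 <= t &
      z = c * lift_size x p t]].
have hS r : has_sup (S r).
  split; first by exists 0; left.
  have [V V0 hV] := optimal_cost_bounded q1 cF pF r.
  have [B B0 hB] := lift_bounded q1 cF vF pF V.
  exists (c * (B + B + B)) => z [->|[x0 [u [x [p [t [x0r opt H t0 ->]]]]]]].
    by rewrite mulr_ge0 ?addr_ge0// ltW.
  have cV := hV _ _ _ (le_trans (normr_le_euclidean_norm x0) x0r) opt.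
  have [h1 h2 h3] := hB x p H (optimal_energy_le opt H cV) t t0.
  by rewrite ler_pM2l// !lerD.
pose M r := sup (S r).
have M0 r : 0 <= M r by apply: (sup_upper_bound (hS r)); left.
have Mm r s : r <= s -> M r <= M s.
  move=> rs; apply: sup_le => //; last by have [] := hS r.
  move=> z Sz; exists z; split => //; case: Sz => [->|]; first by left.
  move=> [x0 [u [x [p [t [x0r opt H t0 ->]]]]]]; right; exists x0, u, x, p, t; split => //.
  exact: le_trans rs.
have [|C hC CM] := @K_infinity_majorant _ M M0 Mm.
  move=> e e0; have e3 : 0 < e / c / 3 by rewrite !divr_gt0.
  have [d d0 hd] := lift_small q1 cF vF pF e3.
  have [h h0 hh] := optimal_cost_small q1 cF pF d0.
  exists h => //; apply: ge_sup; first by have [] := hS h.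
  move=> z [->|[x0 [u [x [p [t [x0r opt H t0 ->]]]]]]]; first exact: ltW.
  have cV := hh _ _ _ (le_trans (normr_le_euclidean_norm x0) x0r) opt.
  have [h1 h2 h3] := hd x p H 0 (lexx 0) (optimal_energy_le opt H cV) t t0.
  by rewrite mulrC -ler_pdivlMr// /lift_size; lra.
exists C => // x0 u x p t opt H t0; apply: le_trans (CM _ (sqrtr_ge0 _)).
by apply: (sup_upper_bound (hS _)); right; exists x0, u, x, p, t.
Qed.

Lemma optimal_vanishing (x0 : 'cV[R]_n.+1) u x p (e : R) : optimal q F x0 u x ->
  extremal_lift q F x p -> 0 < e -> exists2 T, 0 <= T & forall t, T <= t ->
    [/\ `|x t| <= e, `|p t| <= e & `|lift_control q p t| <= e].
Proof.
move=> opt H e0; have [d d0 hd] := lift_small q1 cF vF pF e0.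
have [V V0 hV] := optimal_cost_bounded q1 cF pF `|x0|.
have cV := hV _ _ _ (lexx _) opt; have [hu hx _] := opt.
have [T T0 hT] := nondecreasing_bounded_increment d0 (energy_le q1 cF pF H)
  (energy_le_cost q1 cF pF hu hx H cV).
by exists T => //; exact: (hd x p H T T0 hT).
Qed.

End uniform_bound.

Theorem theorem3p2 (R : realType) (n : nat) (q : R) (hq : 1 < q)
    (F : 'cV[R]_n.+1 -> R) (hF1 : contdiff F)
    (hFconv : convex_function [set: 'cV[R]_n.+1] F)
    (hFpos : positive_definite F) :
  (forall (x0 : 'cV[R]_n.+1) (u : R -> R) (x : R -> 'cV[R]_n.+1),
     optimal q F x0 u x ->
     exists (ubar : R -> R) (p : R -> 'cV[R]_n.+1),
       [/\ continuous_representative u ubar,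
           extremal_lift q F x p,
           forall p' : R -> 'cV[R]_n.+1, extremal_lift q F x p' ->
             forall t, 0 <= t -> p' t = p t &
           forall t, 0 <= t -> ubar t = spow (p t ord_max 0) (q - 1)^-1])
  /\
  (exists C : R -> R, K_infinity C /\
     forall (x0 : 'cV[R]_n.+1) (u ubar : R -> R) (x p : R -> 'cV[R]_n.+1),
       optimal q F x0 u x ->
       continuous_representative u ubar ->
       extremal_lift q F x p ->
       (sup_norm (fun t => col_mx (x t) (col_mx (p t) (ubar t)%:M))
          <= (C (euclidean_norm x0))%:E)%E /\
       (x t, p t, ubar t) @[t --> +oo] -->
         (0 : 'cV[R]_n.+1, 0 : 'cV[R]_n.+1, 0 : R)).
Proof.
have vF := convex_function_is_convex hFconv.
split.
  move=> x0 u x opt; have [p H] := optimal_extremal_lift hq hF1 vF hFpos opt.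
  have [_ hx _] := opt; have [cx cp] := extremal_lift_continuous H.
  exists (lift_control q p), p; split => //.
  - split; last by have := trajectory_control_ae hq hx H.
    apply: (continuous_within0 (continuous_spow_coord hq cp)) => t t0.
    by rewrite max_r.
  - by move=> p' H'; exact: (extremal_lift_unique hq hF1 H H').
(* The dimension of the stacked vector of state, costate and control, which is the factor between
   its coordinate bound and its Euclidean norm. *)
pose m := (n.+1 + (n.+1 + 1))%N.
have [|C hC CM] := optimal_uniform_bound hq hF1 vF hFpos (c := m%:R).
  by rewrite ltr0n.
exists C; split => // x0 u ubar x p opt hu H.
have [_ hx _] := opt.
have ubarE t : 0 <= t -> ubar t = lift_control q p t.
  exact: (continuous_representative_unique hq hx hu H).
split.
  apply: ge_ereal_sup => _ [t /= + <-]; rewrite in_itv/= andbT => t0; rewrite lee_fin.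
  apply: le_trans (CM x0 u x p t opt H t0); rewrite /lift_size -ubarE//.
  apply: euclidean_norm_le_coord; first by rewrite !addr_ge0.
  move=> i.
  have [j ->|j ->] := split_ordP i.
    rewrite col_mxEu; apply: le_trans (normr_coord _ _) _.
    by rewrite -addrA lerDl addr_ge0.
  have [k ->|k ->] := split_ordP j.
    rewrite col_mxEd col_mxEu; apply: le_trans (normr_coord _ _) _.
    by rewrite addrAC lerDr addr_ge0.
  by rewrite !col_mxEd ord1 mxE eqxx mulr1n lerDr addr_ge0.
have lim e : 0 < e -> \forall t \near +oo, [/\ `|x t| <= e, `|p t| <= e & `|ubar t| <= e].
  move=> e0; have [T T0 hT] := optimal_vanishing hq hF1 vF hFpos opt H e0.
  apply: filterS (nbhs_pinfty_ge (num_real T)) => t Tt.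
  by rewrite ubarE ?(le_trans T0)//; exact: hT.
apply/cvgrPdist_le => e e0; apply: filterS (lim e e0) => t [xe pe ue].
by rewrite !prod_normE /= !ge_max /= !sub0r !normrN xe pe.
Qed.
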